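(* Let $H$ be the complete $k$-uniform hypergraph on the vertex set $\{1,\dots,n\}$, and let $\Delta(H)^C=\Delta(E_n)/\Delta(H)$. For $n-2\ge r>n-k$, $$\dim HC_r(\Delta(H)^C)=\binom{n-1}{r+1},$$ and $$\dim HC_{n-k}(\Delta(H)^C)=\binom{n-1}{n-k-1}+\binom{n-1}{n-k+1}.$$
   Context: All vector spaces are over a fixed field of characteristic zero. A hypergraph $H=(V,E)$ consists of a vertex set $V=\{1,\dots,n\}$ and a set $E$ of subsets of $V$ (hyperedges). It is complete $k$-uniform if its hyperedges are exactly the $k$-element subsets of $V$. For $r\ge -1$ consider ordered set partitions $(B_1,\dots,B_{r+2})$ of $\{1,\dots,n\}$ into nonempty blocks, modulo the signed cyclic relation $(B_1,\dots,B_{r+2})\sim(-1)^{r+1}(B_{\sigma(1)},\dots,B_{\sigma(r+2)})$, where $\sigma=(1,2,\dots,r+2)$ is the cyclic permutation. The class is written $[B_1,\dots,B_{r+2}]$ and is represented by the unique representative with $1\in B_1$. The complex $\Delta(E_n)$ (where $E_n$ is the complete graph on $\{1,\dots,n\}$ with a loop at each vertex) has as its degree-$r$ term the vector space $C_r(E_n)$ with basis all $[B_1,\dots,B_{r+2}]$ with $1\in B_1$, with boundary $$\partial_r([B_1,\dots,B_{r+2}])=\sum_{i=1}^{r+1}(-1)^{i+1}[B_1,\dots,B_i\cup B_{i+1},\dots,B_{r+2}]+(-1)^{r+3}[B_1\cup B_{r+2},B_2,\dots,B_{r+1}]$$ for $r\ge 0$, and $\partial_{-1}=0$. The cyclic coloring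 complex $\Delta(H)$ of a hypergraph $H$ is the subcomplex of $\Delta(E_n)$ spanned in degree $r$ by those $[B_1,\dots,B_{r+2}]$ for which at least one $B_i$ contains a hyperedge of $H$. The quotient complex $\Delta(H)^C=\Delta(E_n)/\Delta(H)$ has as degree-$r$ basis those $[B_1,\dots,B_{r+2}]$ (with $1\in B_1$) for which no $B_i$ contains a hyperedge of $H$; terms of the boundary in which some block contains a hyperedge of $H$ are set to zero. For each of these complexes, $HC_r$ denotes the $r$-th homology group $\ker\partial_r/\operatorname{im}\partial_{r+1}$. Binomial coefficients with negative lower index are $0$.
   Formalization: The formula for the dimension of HC_{n-k} is stated only when some r satisfies n-2 ≥ r > n-k, that is for k ≥ 3; without this it fails, e.g. for n=4, k=2 the dimension is 6 while the formula gives 4. *)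

(* Defs.v *)
From HB Require Import structures.
From mathcomp Require Import all_boot all_order all_algebra.

Set Implicit Arguments.
Unset Strict Implicit.
Unset Printing Implicit Defensive.

Import GRing.Theory.
Local Open Scope ring_scope.

(* The vertex set {1, ..., n} is encoded as 'I_n = {0, ..., n-1}, so the       *)
(* distinguished vertex 1 is the ordinal of value 0.                           *)
Definition hypergraph (n : nat) := {set {set 'I_n}}.

Definition complete_uniform (n k : nat) : hypergraph n :=
  [set e : {set 'I_n} | #|e| == k].

Section OrderedPartitions.
Variable n : nat.
Implicit Type s : seq {set 'I_n}.

Definition ordered_partition s : bool :=
  [&& set0 \notin s, pairwise (fun A B : {set 'I_n} => [disjoint A & B]) s
    & \bigcup_(B <- s) B == setT].

Definition has_vertex1 (B : {set 'I_n}) : bool := [exists v in B, val v == 0%N].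

Definition basis_partition s : bool :=
  ordered_partition s && has_vertex1 (head set0 s).

(* [merge i s] joins the blocks i and i+1 of s (blocks numbered from 0);       *)
(* [wrap s] turns B_1, ..., B_m into B_1 U B_m, B_2, ..., B_{m-1}.             *)
Definition merge (i : nat) s : seq {set 'I_n} :=
  take i s ++ (nth set0 s i :|: nth set0 s i.+1) :: drop i.+2 s.

Definition wrap s : seq {set 'I_n} :=
  (head set0 s :|: last set0 s) :: drop 1 (take (size s).-1 s).

Definition has_edge (H : hypergraph n) s : bool :=
  has (fun B : {set 'I_n} => [exists e in H, e \subset B]) s.

End OrderedPartitions.

(* Complexes are indexed below by the number m of blocks: the objects with     *)
(* index m live in degree r = m - 2.                                           *)

Definition cbasis (n m : nat) : Type :=
  {x : m.-tuple {set 'I_n} | basis_partition x}.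
HB.instance Definition _ n m := Finite.on (cbasis n m).

Definition qbasis (n : nat) (H : hypergraph n) (m : nat) : Type :=
  {x : cbasis n m | ~~ has_edge H (val x)}.
HB.instance Definition _ n H m := Finite.on (@qbasis n H m).

Section Complexes.
Variables (F : fieldType) (n : nat).

Definition chain (m : nat) : vectType F := {ffun cbasis n m -> F^o}.

Definition bvec m (x : cbasis n m) : chain m := [ffun y => (y == x)%:R].

(* The class [B_1, ..., B_m] of s = (B_1, ..., B_m), expressed on the basis:   *)
(* s is rotated until vertex 1 is in the first block, and each rotation by one *)
(* contributes the sign (-1)^(r+1) = (-1)^(m-1).                               *)
Definition bracket m (s : seq {set 'I_n}) : chain m :=
  let j := find (@has_vertex1 n) s in
  [ffun y : cbasis n m =>
     if tval (val y) == rot j s then (-1) ^+ (j * (size s).-1) else 0].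

Definition bd_basis m (x : cbasis n m.+1) : chain m :=
  \sum_(i < m) (-1) ^+ i *: bracket m (merge i (val x))
  + (-1) ^+ m.+2 *: bracket m (wrap (val x)).

(* [bd m] is the boundary of degree r = m - 1, from m+1 blocks to m blocks.    *)
(* For m = 0 its target is the zero space.                                     *)
Definition bd_fun m (c : chain m.+1) : chain m :=
  \sum_(x : cbasis n m.+1) c x *: bd_basis x.

Lemma bd_fun_is_linear m : linear (@bd_fun m).
Proof.
move=> a c d; rewrite /bd_fun scaler_sumr -big_split /=.
by apply: eq_bigr => x _; rewrite !ffunE scalerDl scalerA.
Qed.
HB.instance Definition _ m := GRing.isLinear.Build F (chain m.+1) (chain m) *:%R
  (@bd_fun m) (@bd_fun_is_linear m).

Definition bd m : 'Hom(chain m.+1, chain m) := linfun (@bd_fun m).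

Variable H : hypergraph n.

Definition coloring_complex m : {vspace chain m} :=
  <<[seq bvec x | x <- enum [pred x : cbasis n m | has_edge H (val x)]]>>%VS.

Definition qchain (m : nat) : vectType F := {ffun qbasis H m -> F^o}.

(* Setting to zero the classes in which some block contains a hyperedge; its   *)
(* kernel is [coloring_complex m] (see [lker_qproj]), so that [qchain m] is    *)
(* the quotient of [chain m] by [coloring_complex m].                          *)
Definition qproj_fun m (c : chain m) : qchain m := [ffun y => c (val y)].

Definition qlift_fun m (c : qchain m) : chain m :=
  \sum_(y : qbasis H m) c y *: bvec (val y).

Lemma qproj_fun_is_linear m : linear (@qproj_fun m).
Proof. by move=> a c d; apply/ffunP=> y; rewrite !ffunE. Qed.
HB.instance Definition _ m := GRing.isLinear.Build F (chain m) (qchain m) *:%R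
  (@qproj_fun m) (@qproj_fun_is_linear m).

Lemma qlift_fun_is_linear m : linear (@qlift_fun m).
Proof.
move=> a c d; rewrite /qlift_fun scaler_sumr -big_split /=.
by apply: eq_bigr => x _; rewrite !ffunE scalerDl scalerA.
Qed.
HB.instance Definition _ m := GRing.isLinear.Build F (qchain m) (chain m) *:%R
  (@qlift_fun m) (@qlift_fun_is_linear m).

Definition qproj m : 'Hom(chain m, qchain m) := linfun (@qproj_fun m).
Definition qlift m : 'Hom(qchain m, chain m) := linfun (@qlift_fun m).

Definition qbd m : 'Hom(qchain m.+1, qchain m) :=
  (qproj m \o (bd m \o qlift m.+1))%VF.

End Complexes.

(* MathComp has no quotient of vector spaces: [lker g :\: limg f] is a         *)
(* complement in ker g of its intersection with im f, hence is isomorphic to   *)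
(* ker g / im f when im f is included in ker g.                                *)
Definition homology (F : fieldType) (A B C : vectType F)
  (f : 'Hom(A, B)) (g : 'Hom(B, C)) : {vspace B} := (lker g :\: limg f)%VS.

(* Degrees below -1 carry the zero space.                                      *)
Definition dimHC_quotient (F : fieldType) (n : nat) (H : hypergraph n)
  (r : int) : nat :=
  if (r + 1)%R is Posz m then \dim (homology (qbd F H m.+1) (qbd F H m)) else 0%N.

Definition binz (m : nat) (j : int) : nat :=
  if j is Posz i then 'C(m, i) else 0%N.

Section Checks.
Variables (F : fieldType) (n : nat).

Lemma bracket_basis m (x : cbasis n m) : bracket F m (val x) = bvec F x.
Proof.
apply/ffunP=> y; rewrite !ffunE.
have /andP[_ h1] := valP x.
have -> : find (@has_vertex1 n) (val x) = 0%N.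
  case: (tval (val x)) h1 => [|B s] /=; first by case/existsP=> v; rewrite inE.
  by move=> ->.
by rewrite rot0 mul0n expr0 -val_eqE -[val y == val x]val_eqE; case: eqP.
Qed.

Lemma bracket_cyclic m (s : seq {set 'I_n}) : (0 < n)%N ->
  ordered_partition s ->
  bracket F m s = (-1) ^+ (size s).-1 *: bracket F m (rot 1 s).
Proof.
move=> n_gt0 /and3P[_ dis /eqP cov].
have hs : has (@has_vertex1 n) s.
  have : Ordinal n_gt0 \in \bigcup_(B <- s) B by rewrite cov inE.
  rewrite bigcup_seq => /bigcupP[B Bs vB]; apply/hasP; exists B => //.
  by apply/existsP; exists (Ordinal n_gt0); rewrite vB eqxx.
case: s dis hs {cov} => // B t /= /andP[disB _] hs.
apply/ffunP=> y; rewrite !ffunE rot1_cons size_rcons /=.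
case: (boolP (has_vertex1 B)) hs => [hB _|nB /= ht].
  have nt : ~~ has (@has_vertex1 n) t.
    apply/hasPn=> C Ct; apply/negP=> /existsP[v /andP[vC /eqP v0]].
    have /existsP[w /andP[wB /eqP w0]] := hB.
    have vw : v = w by apply/val_inj; rewrite v0 w0.
    move/allP: disB => /(_ C Ct) /disjointFr /(_ wB).
    by rewrite -vw vC.
  rewrite -cats1 find_cat (negbTE nt) /= hB addn0 rot_size_cat /= rot0 mul0n.
  case: eqP => _; last by rewrite scaler0.
  rewrite expr0 /GRing.scale /= -exprD -mulSn -signr_odd oddM /=.
  by rewrite andNb expr0.
rewrite -cats1 find_cat ht.
have lt_t : (find (@has_vertex1 n) t < size t)%N by rewrite -has_find.
have -> : rot (find (@has_vertex1 n) t).+1 (B :: t)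
        = rot (find (@has_vertex1 n) t) (t ++ [:: B]).
  by rewrite /rot /= drop_cat take_cat lt_t -catA.
case: eqP => _; last by rewrite scaler0.
by rewrite /GRing.scale /= -exprD mulSn.
Qed.

Lemma chain_sum m (c : chain F n m) : c = \sum_x c x *: bvec F x.
Proof.
apply/ffunP=> y; rewrite sum_ffunE (bigD1 y) //= big1 ?addr0.
  by rewrite !ffunE eqxx /GRing.scale /= mulr1.
by move=> x; rewrite !ffunE eq_sym => /negbTE->; rewrite scaler0.
Qed.

Lemma bd_bvec m (x : cbasis n m.+1) : bd F n m (bvec F x) = bd_basis F x.
Proof.
rewrite lfunE /= /bd_fun (bigD1 x) //= big1 ?addr0.
  by rewrite !ffunE eqxx scale1r.
by move=> y /negbTE yx; rewrite !ffunE yx scale0r.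
Qed.

Variable H : hypergraph n.

Lemma lker_qproj m : lker (qproj F H m) = coloring_complex F H m.
Proof.
apply/eqP; rewrite eqEsubv; apply/andP; split.
  apply/subvP=> c; rewrite memv_ker lfunE => /eqP /ffunP c0.
  rewrite [c]chain_sum; apply: rpred_sum => x _.
  case: (boolP (has_edge H (val x))) => hx.
    by apply/rpredZ/memv_span/map_f; rewrite mem_enum inE.
  by have := c0 (Sub x hx); rewrite !ffunE SubK => ->; rewrite scale0r rpred0.
apply/span_subvP=> c /mapP[x]; rewrite mem_enum inE => hx -> {c}.
rewrite memv_ker lfunE; apply/eqP/ffunP=> y; rewrite !ffunE.
by case: eqP => // yx; have := valP y; rewrite yx hx.
Qed.

Lemma qprojK m (c : qchain F H m) : qproj F H m (qlift F H m c) = c.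
Proof.
rewrite !lfunE; apply/ffunP=> y; rewrite !ffunE sum_ffunE (bigD1 y) //= big1.
  by rewrite addr0 !ffunE eqxx /GRing.scale /= mulr1.
by move=> z zy; rewrite !ffunE val_eqE eq_sym (negbTE zy) scaler0.
Qed.

Lemma bracket_coloring m (s : seq {set 'I_n}) :
  has_edge H s -> bracket F m s \in coloring_complex F H m.
Proof.
move=> hs; rewrite [bracket F m s]chain_sum; apply: rpred_sum => x _.
rewrite ffunE; case: eqP => [xs|_]; last by rewrite scale0r rpred0.
apply/rpredZ/memv_span/map_f; rewrite mem_enum inE.
by rewrite /has_edge /= xs has_rot.
Qed.

Lemma edge_block (A B : {set 'I_n}) : A \subset B ->
  [exists e in H, e \subset A] -> [exists e in H, e \subset B].
Proof.
move=> AB /existsP[e /andP[eH eA]]; apply/existsP; exists e.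
by rewrite eH (subset_trans eA).
Qed.

Lemma has_edge_merge i (s : seq {set 'I_n}) : (i.+1 < size s)%N ->
  has_edge H s -> has_edge H (merge i s).
Proof.
move=> lt_i; rewrite /has_edge /merge has_cat /=.
rewrite -{1}[s](cat_take_drop i) has_cat (drop_nth set0) 1?ltnW //=.
rewrite (drop_nth set0) //=; case: has => //=.
case/or3P=> [h|h|->]; last by rewrite orbT.
  by rewrite (edge_block _ h) ?subsetUl.
by rewrite (edge_block _ h) ?subsetUr.
Qed.

Lemma has_edge_wrap (s : seq {set 'I_n}) : (1 < size s)%N ->
  has_edge H s -> has_edge H (wrap s).
Proof.
case: s => [|A s] //; case/lastP: s => // s B _.
rewrite /has_edge /wrap /= last_rcons size_rcons /= drop0 -cats1 take_size_cat //.
rewrite has_cat /= orbF; case/or3P=> [h|->|h]; last 1 first.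
- by rewrite (edge_block _ h) ?subsetUr.
- by rewrite (edge_block _ h) ?subsetUl.
by rewrite orbT.
Qed.

Lemma coloring_subcomplex m :
  (bd F n m @: coloring_complex F H m.+1 <= coloring_complex F H m)%VS.
Proof.
rewrite limg_span; apply/span_subvP=> c /mapP[_ /mapP[x + ->] ->] {c}.
rewrite mem_enum inE bd_bvec => hx; apply: rpredD.
  apply: rpred_sum => i _; apply/rpredZ/bracket_coloring/has_edge_merge => //.
  by rewrite size_tuple ltnS.
case: m x hx => [|m] x hx; last first.
  by apply/rpredZ/bracket_coloring/has_edge_wrap; rewrite ?size_tuple.
rewrite [X in _ *: X](_ : _ = 0) ?scaler0 ?rpred0 //.
apply/ffunP=> y; have /andP[_] := valP y.
by rewrite [val y]tuple0 => /existsP[v]; rewrite inE.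
Qed.

Lemma qbd_qproj m (c : chain F n m.+1) :
  qbd F H m (qproj F H m.+1 c) = qproj F H m (bd F n m c).
Proof.
rewrite !comp_lfunE; apply/eqP; rewrite -subr_eq0 -linearB -linearB /=.
rewrite -memv_ker lker_qproj; apply: (subvP (coloring_subcomplex m)).
by apply/memv_img; rewrite -lker_qproj memv_ker linearB /= qprojK subrr.
Qed.

End Checks.

(* Main.v *)
Require Import Defs.
From HB Require Import structures.
From mathcomp Require Import all_boot all_order all_fingroup all_algebra zify ring.

(* Every class has a representative with vertex 1 in the first block, and all *)
(* faces keep it there, so the boundary is an alternating sum of faces        *)
(* without the cyclic signs. A discrete Morse matching (split or merge the    *)
(* first vertex that breaks the order of the labels) bounds the cycles from   *)
(* above; its critical cells have increasing singletons after the first       *)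
(* block, and antisymmetrizing them gives cycles that vanish on the matched   *)
(* lower cells. Hence equality: HC_r of the whole complex has dimension       *)
(* C(n-1, r+1). For H k-uniform, the coloring complex vanishes above degree   *)
(* n-k-1, where its cells have one block of size k and singletons. Since k >  *)
(* 2, the cycles among these are antisymmetric under exchange of singletons,  *)
(* which leaves one for each set of n-k singletons. They contain the          *)
(* antisymmetrized critical cells, so C(n, n-k) - C(n-1, n-k) = C(n-1, n-k-1) *)
(* of them are boundaries, and these become new cycles in degree n-k of the   *)
(* quotient.                                                                  *)

Import GRing.Theory Num.Theory.
Local Open Scope ring_scope.

Set Implicit Arguments.
Unset Strict Implicit.
Unset Printing Implicit Defensive.

Section Labellings.
Local Open Scope nat_scope.
Variable n : nat.
Local Notation V := 'I_n.+1.
Local Notation labelling := {ffun V -> nat}.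
Implicit Types f g : labelling.

Definition block_label m (x : cbasis n.+1 m) : labelling :=
  [ffun v => find (fun B : {set V} => v \in B) (val x)].

Definition normal m f : bool :=
  [&& f ord0 == 0, [forall v, f v < m] & [forall i : 'I_m, exists v, f v == i]].

Lemma normalP m f : reflect [/\ f ord0 = 0, forall v, f v < m
  & forall i, i < m -> exists v, f v = i] (normal m f).
Proof.
apply: (iffP and3P) => [[/eqP f0 /forallP fm /forallP fs]|[f0 fm fs]].
  by split=> // i im; have /existsP[v /eqP] := fs (Ordinal im); exists v.
split; [exact/eqP|exact/forallP|apply/forallP=> i].
by have [v /eqP fv] := fs i (ltn_ord i); apply/existsP; exists v.
Qed.

Lemma mem_block m (x : cbasis n.+1 m) j v :
  j < m -> (v \in nth set0 (val x) j) = (block_label x v == j).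
Proof.
move=> jm; rewrite ffunE; have sx := size_tuple (val x).
have /andP[/and3P[_ /(pairwiseP set0) dis /eqP cov] _] := valP x.
have hs : has (fun B : {set V} => v \in B) (val x).
  have : v \in \bigcup_(B <- val x) B by rewrite cov inE.
  by rewrite bigcup_seq => /bigcupP[B Bs vB]; apply/hasP; exists B.
have vi := nth_find set0 hs; move: hs; rewrite has_find sx.
set i := find _ _ in vi * => im; apply/idP/eqP => [vj|<- //].
case: (ltngtP i j) => // ij.
  by have := dis i j; rewrite !inE sx => /(_ im jm ij) /disjointFr /(_ vi); rewrite vj.
by have := dis j i; rewrite !inE sx => /(_ jm im ij) /disjointFr /(_ vj); rewrite vi.
Qed.

Lemma block_label_normal m (x : cbasis n.+1 m) : normal m (block_label x).
Proof.
have sx := size_tuple (val x).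
have /andP[/and3P[ne _ /eqP cov] h1] := valP x.
apply/normalP; split=> [|v|i im].
- case: m x sx ne cov h1 => [|m] x sx ne cov h1.
    by move: h1; rewrite [val x]tuple0 => /existsP[v]; rewrite inE.
  apply/eqP; rewrite -mem_block // nth0.
  by have /existsP[v /andP[vh /eqP v0]] := h1; rewrite -(_ : v = ord0) //; apply/val_inj.
- rewrite ffunE; apply: leq_trans (_ : size (val x) <= m); last by rewrite sx.
  rewrite -has_find.
  have : v \in \bigcup_(B <- val x) B by rewrite cov inE.
  by rewrite bigcup_seq => /bigcupP[B Bs vB]; apply/hasP; exists B.
have : nth set0 (val x) i \in tval (val x) by rewrite mem_nth ?sx.
have [->|/set0Pn[v vi] _] := eqVneq (nth set0 (val x) i) set0; first by rewrite (negPf ne).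
by exists v; apply/eqP; rewrite -mem_block.
Qed.

Lemma label_eq m (y : cbasis n.+1 m) (t : seq {set V}) f : size t = m ->
  (forall j v, j < m -> (v \in nth set0 t j) = (f v == j)) ->
  (tval (val y) == t) = (block_label y == f).
Proof.
move=> st tE; have sy := size_tuple (val y).
have /normalP[_ ym _] := block_label_normal y.
apply/eqP/eqP => [yt|yf].
  apply/ffunP=> v; apply/esym/eqP; rewrite -tE ?ym // -yt mem_block ?ym //.
apply: (@eq_from_nth _ set0); rewrite sy // => j jm.
by apply/setP=> v; rewrite mem_block // tE // yf.
Qed.

Lemma block_label_inj m : injective (@block_label m).
Proof.
move=> x y /eqP; rewrite -(@label_eq _ x (val y) (block_label y)) ?size_tuple //.
  by move/eqP=> xy; do 2 apply/val_inj.
by move=> j v jm; rewrite mem_block.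
Qed.

Lemma block_label_onto m f : normal m f -> exists x : cbasis n.+1 m, block_label x = f.
Proof.
case/normalP=> f0 fm fs.
pose s := [seq [set v | f v == i] | i <- iota 0 m].
have ss : size s == m by rewrite size_map size_iota.
have nths j : j < m -> nth set0 s j = [set v | f v == j].
  by move=> jm; rewrite (nth_map 0) ?size_iota // nth_iota.
have bp : basis_partition (Tuple ss).
  apply/andP; split; last first.
    rewrite -nth0 /= nths ?(leq_trans _ (fm ord0)) //.
    by apply/existsP; exists ord0; rewrite inE f0 eqxx.
  apply/and3P; split.
  - apply/mapP=> -[i]; rewrite mem_iota => /andP[_ im] /setP E.
    by have [v fv] := fs i im; have := E v; rewrite !inE fv eqxx.
  - apply/(pairwiseP set0) => i j; rewrite !inE (eqP ss) => im jm ij.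
    rewrite !nths // disjoint_subset; apply/subsetP=> v; rewrite !inE => /eqP->.
    by rewrite ltn_eqF.
  apply/eqP/setP=> v; rewrite inE bigcup_seq; apply/bigcupP.
  exists [set w | f w == f v]; last by rewrite inE.
  by apply/mapP; exists (f v); rewrite // mem_iota fm.
exists (Sub (Tuple ss) bp); apply/eqP; rewrite -(@label_eq _ _ s) /= ?SubK ?(eqP ss) //.
by move=> j v jm; rewrite nths // inE.
Qed.

(* Merging the cyclically consecutive blocks i and i+1 of m+1 blocks; [i = m] *)
(* merges the last block into the first one.                                   *)
Definition face_label m i a :=
  if i == m then (if a == m then 0 else a) else (if a <= i then a else a.-1).

Definition face m i f : labelling := [ffun v => face_label m i (f v)].

Lemma faceE m i f v : face m i f v = face_label m i (f v).
Proof. exact: ffunE. Qed.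

Lemma face_face m i j f : normal m.+2 f -> i < j -> j <= m.+1 ->
  face m i (face m.+1 j f) = face m j.-1 (face m.+1 i f).
Proof.
case/normalP=> _ fm _ ij jm; apply/ffunP=> v; rewrite !ffunE /face_label.
move: (f v) (fm v) => a am; repeat case: ifP; lia.
Qed.

Lemma face_normal m i f : normal m.+2 f -> i <= m.+1 -> normal m.+1 (face m.+1 i f).
Proof.
case/normalP=> f0 fm fs im; apply/normalP; split=> [|v|k km].
- by rewrite ffunE f0 /face_label; repeat case: ifP; lia.
- by rewrite ffunE /face_label; move: (fm v); repeat case: ifP; lia.
have [v fv] : exists v, f v = (if k <= i then k else k.+1) by apply: fs; case: ifP; lia.
by exists v; rewrite ffunE /face_label fv; repeat case: ifP; lia.
Qed.

Lemma merge_block m (x : cbasis n.+1 m.+1) i j v : i < m -> j < m ->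
  (v \in nth set0 (Defs.merge i (val x)) j) = (face m i (block_label x) v == j).
Proof.
move=> im jm; have sx := size_tuple (val x).
rewrite ffunE nth_cat size_takel; last by rewrite sx; lia.
case: (ltngtP j i) => [ji|ij|ji].
- rewrite nth_take // mem_block; last lia.
  rewrite /face_label; repeat case: ifP; lia.
- have -> : j - i = (j - i.+1).+1 by lia.
  rewrite /= nth_drop mem_block; last lia.
  by rewrite /face_label; repeat case: ifP; lia.
rewrite ji subnn /= inE !mem_block; try lia.
by rewrite /face_label; repeat case: ifP; lia.
Qed.

Lemma wrap_block m (x : cbasis n.+1 m.+2) j v : j < m.+1 ->
  (v \in nth set0 (Defs.wrap (val x)) j) = (face m.+1 m.+1 (block_label x) v == j).
Proof.
move=> jm; have sx := size_tuple (val x).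
rewrite ffunE /Defs.wrap sx /=; case: j jm => [|j] jm /=.
  rewrite inE -nth0 -nth_last sx !mem_block //= /face_label eqxx; repeat case: ifP; lia.
rewrite nth_drop nth_take // mem_block; last lia.
rewrite /face_label eqxx; repeat case: ifP; lia.
Qed.

End Labellings.

Section Boundary.
Variables (F : fieldType) (n : nat).
Local Notation V := 'I_n.+1.
Local Notation labelling := {ffun V -> nat}.
Implicit Types f g : labelling.

(* Zero when f is not the labelling of an ordered partition into m blocks.    *)
Definition cell m f : chain F n.+1 m := [ffun y => (block_label y == f)%:R].

Lemma cell_block_label m (x : cbasis n.+1 m) : cell m (block_label x) = bvec F x.
Proof. by apply/ffunP=> y; rewrite !ffunE (inj_eq (@block_label_inj n m)). Qed.

Lemma bracket_cell m (t : seq {set V}) f : (0 < m)%N -> size t = m -> f ord0 = 0%N ->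
  (forall j v, (j < m)%N -> (v \in nth set0 t j) = (f v == j)) ->
  bracket F m t = cell m f.
Proof.
move=> m0 st f0 tE; apply/ffunP=> y; rewrite !ffunE.
have -> : find (@has_vertex1 n.+1) t = 0%N.
  have : has_vertex1 (nth set0 t 0) by apply/existsP; exists ord0; rewrite tE // f0 eqxx.
  by case: t {tE} st m0 => [<-|A t _ _ /= ->].
by rewrite rot0 mul0n expr0 (label_eq y st tE); case: eqP.
Qed.

Lemma cbasis0 (x : cbasis n.+1 0) : false.
Proof. by have /normalP[_ /(_ ord0)] := block_label_normal x. Qed.

Lemma chain0_eq0 (c : chain F n.+1 0) : c = 0.
Proof. by apply/ffunP=> x; have := cbasis0 x. Qed.

Lemma bd_basisE m (x : cbasis n.+1 m.+1) :
  bd_basis F x = \sum_(i < m.+1) (-1) ^+ i *: cell m (face m i (block_label x)).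
Proof.
case: m x => [|m] x; first by rewrite [LHS]chain0_eq0 [RHS]chain0_eq0.
have sx := size_tuple (val x); have /normalP[x0 _ _] := block_label_normal x.
rewrite /bd_basis [RHS]big_ord_recr /=; congr (_ + _).
  apply: eq_bigr => i _; congr (_ *: _); apply: bracket_cell => //.
  - by rewrite size_cat /= size_take size_drop sx; case: i => i /= ?; case: ifP; lia.
  - by rewrite ffunE x0 /face_label; repeat case: ifP.
  by move=> j v jm; rewrite merge_block.
rewrite !exprS !mulN1r opprK; congr (_ *: _); apply: bracket_cell => //.
- by rewrite /= size_drop size_take sx; case: ifP; lia.
- by rewrite ffunE x0 /face_label; repeat case: ifP.
by move=> j v jm; rewrite wrap_block.
Qed.

Lemma bd_cell m f : normal m.+1 f ->
  bd F n.+1 m (cell m.+1 f) = \sum_(i < m.+1) (-1) ^+ i *: cell m (face m i f).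
Proof.
by case/block_label_onto=> x <-; rewrite cell_block_label bd_bvec bd_basisE.
Qed.

Lemma bd_coef m (c : chain F n.+1 m.+1) (y : cbasis n.+1 m) :
  bd F n.+1 m c y = \sum_x c x * \sum_(i < m.+1)
    (-1) ^+ i * (block_label y == face m i (block_label x))%:R.
Proof.
rewrite lfunE /= /bd_fun sum_ffunE; apply: eq_bigr => x _.
rewrite ffunE bd_basisE sum_ffunE; congr (_ * _).
by apply: eq_bigr => i _; rewrite !ffunE.
Qed.

Lemma bd_bd m (c : chain F n.+1 m.+2) : bd F n.+1 m (bd F n.+1 m.+1 c) = 0.
Proof.
case: m c => [|m] c; first exact: chain0_eq0.
rewrite [c]chain_sum !linear_sum /= big1 // => x _.
rewrite !linearZ /=; apply/eqP; rewrite scaler_eq0; apply/orP; right; apply/eqP.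
have nx := block_label_normal x; set f := block_label x in nx.
rewrite -cell_block_label bd_cell // linear_sum /=.
under eq_bigr => i _ do
  rewrite linearZ /= bd_cell ?face_normal -1?ltnS ?ltn_ord // scaler_sumr.
rewrite pair_big /=.
pose G (p : 'I_m.+3 * 'I_m.+2) : chain F n.+1 m.+1 := (-1) ^+ p.1 *:
  ((-1) ^+ p.2 *: cell m.+1 (face m.+1 p.2 (face m.+2 p.1 f))).
rewrite -/(G _) (eq_bigr G) // (bigID (fun p : 'I_m.+3 * 'I_m.+2 => (p.2 < p.1)%N)) /=.
pose h (p : 'I_m.+3 * 'I_m.+2) : 'I_m.+3 * 'I_m.+2 :=
  if (p.2 < p.1)%N then (inord p.2, inord p.1.-1) else (inord p.2.+1, inord p.1).
have hK : involutive h.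
  case=> i j; have im := ltn_ord i; have jm := ltn_ord j; rewrite /h /=.
  case: (ltnP j i) => ij /=; rewrite !inordK; try lia.
    by case: ifP => H; [lia|congr pair; apply/val_inj; rewrite /= inordK; lia].
  by case: ifP => H; [congr pair; apply/val_inj; rewrite /= inordK; lia|lia].
rewrite [X in _ + X](reindex_inj (inv_inj hK)) /=.
rewrite [X in _ + X](eq_bigl (fun p : 'I_m.+3 * 'I_m.+2 => (p.2 < p.1)%N)); last first.
  case=> i j; have im := ltn_ord i; have jm := ltn_ord j; rewrite /h /=.
  by case: (ltnP j i) => ij /=; rewrite !inordK; lia.
rewrite -big_split /= big1 // => -[i j] /= ij.
have im := ltn_ord i; have jm := ltn_ord j.
rewrite /G /h ij /= !inordK; try lia.
rewrite (face_face nx ij) ?ltnS -1?ltnS // !scalerA -scalerDl -!exprD.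
have -> : (i + j = (j + i.-1).+1)%N by lia.
by rewrite exprS mulN1r addNr scale0r.
Qed.

End Boundary.

Section Matching.
Local Open Scope nat_scope.
Variable n : nat.
Local Notation V := 'I_n.+1.
Local Notation labelling := {ffun V -> nat}.
Implicit Types (f g u l : labelling) (s t v w : V).

Definition bad f t := (f t != 0) && [exists v : V, [&& t < v, f v != 0 & f v <= f t]].

Definition min_bad f t := bad f t && [forall w : V, (w < t) ==> ~~ bad f w].

Definition lone f t := [forall v, (f v == f t) ==> (v == t)].

(* A labelling is matched according to its first bad vertex t: if t is alone   *)
(* in its block, the block is merged into the preceding one; otherwise t is    *)
(* split off into a new block placed just after.                               *)
Definition upper f := [exists t, min_bad f t && lone f t].
Definition lower f := [exists t, min_bad f t && ~~ lone f t].
Definition critical f := [forall t, ~~ bad f t].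

Lemma badP f t : reflect (f t != 0 /\ exists v : V, [/\ t < v, f v != 0 & f v <= f t]) (bad f t).
Proof.
apply: (iffP andP) => -[f0]; first by case/existsP=> v /and3P[]; split=> //; exists v.
by case=> v [tv v0 vt]; split=> //; apply/existsP; exists v; apply/and3P.
Qed.

Lemma min_badP f t : reflect (bad f t /\ forall w : V, w < t -> ~~ bad f w) (min_bad f t).
Proof.
apply: (iffP andP) => -[bt h]; split=> //; first by move=> w wt; apply: (implyP (forallP h w)).
by apply/forallP=> w; apply/implyP/h.
Qed.

Lemma loneP f t : reflect (forall v, f v = f t -> v = t) (lone f t).
Proof.
apply: (iffP forallP) => h v; first by move/eqP=> e; apply/eqP; apply: implyP (h v) e.
by apply/implyP=> /eqP/h->.
Qed.

Lemma min_bad_inj f s t : min_bad f s -> min_bad f t -> s = t.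
Proof.
move=> /min_badP[bs ms] /min_badP[bt mt]; case: (ltngtP s t) => [st|ts|/val_inj //].
  by rewrite (negPf (mt _ st)) in bs.
by rewrite (negPf (ms _ ts)) in bt.
Qed.

Lemma bad_min_bad f t : bad f t -> exists2 s : V, s <= t & min_bad f s.
Proof.
move=> bt; case: (arg_minnP (fun v : V => v : nat) bt) => s bs ms.
exists s; first exact: ms.
by apply/min_badP; split=> // w; rewrite ltnNge; apply: contra => /ms.
Qed.

Lemma upper_lowerN f : upper f -> ~~ lower f.
Proof.
case/existsP=> s /andP[ms ls]; apply/existsP=> -[t /andP[mt]].
by rewrite -(min_bad_inj ms mt) ls.
Qed.

Lemma criticalN f : ~~ critical f = upper f || lower f.
Proof.
apply/idP/idP => [|/orP[] /existsP[t /andP[/min_badP[bt _] _]]].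
- case/forallPn=> t; rewrite negbK => /bad_min_bad[s _ ms].
  by case: (boolP (lone f s)) => ls; apply/orP; [left|right]; apply/existsP; exists s;
    rewrite ms ls.
- by apply/forallPn; exists t; rewrite negbK.
by apply/forallPn; exists t; rewrite negbK.
Qed.

Lemma bad_face m i u t : normal m.+1 u -> 0 < i < m -> bad u t -> bad (face m i u) t.
Proof.
case/normalP=> _ um _ im /badP[t0 [v [tv v0 vt]]]; apply/badP; rewrite !ffunE.
have := um v; have := um t; rewrite /face_label => ut uv; split; first by repeat case: ifP; lia.
by exists v; split=> //; rewrite ffunE /face_label; repeat case: ifP; lia.
Qed.

Lemma min_bad_lone_gt1 u t : min_bad u t -> lone u t -> 1 < u t.
Proof.
case/min_badP=> /badP[t0 [v [tv v0 vt]]] _ /loneP lt.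
have : u v != u t by apply/eqP=> /lt vt'; rewrite vt' ltnn in tv.
lia.
Qed.

Definition collapse m u t := face m (u t).-1 u.

Lemma collapse_min_bad m u t : normal m.+1 u -> min_bad u t -> lone u t ->
  min_bad (collapse m u t) t.
Proof.
move=> nu mt lt; have t1 := min_bad_lone_gt1 mt lt.
have [_ um _] := normalP _ _ nu; have [bt ht] := min_badP _ _ mt.
apply/min_badP; split.
  by apply: bad_face => //; have := um t; lia.
move=> w wt; apply/negP=> /badP[]; rewrite !ffunE => w0 [v []]; rewrite ffunE => wv v0 vw.
have utm := um t; have uwm := um w; have uvm := um v.
have w0' : u w != 0 by move: w0; rewrite /face_label; repeat case: ifP; lia.
have v0' : u v != 0 by move: v0; rewrite /face_label; repeat case: ifP; lia.
have wvN : ~~ (u v <= u w).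
  by apply: contra (ht w wt) => vw'; apply/badP; split=> //; exists v.
have [vt wt'] : u v = u t /\ u w = (u t).-1.
  by move: v0 vw; rewrite /face_label; repeat case: ifP; lia.
case/badP: bt => _ [v' [tv' v'0 v't]].
have v'tN : u v' != u t.
  by apply/eqP=> /(loneP _ _ lt) e; rewrite e ltnn in tv'.
by case/negP: (ht w wt); apply/badP; split=> //; exists v'; split; lia.
Qed.

Lemma collapse_normal m u t : normal m.+1 u -> min_bad u t -> lone u t ->
  normal m (collapse m u t).
Proof.
move=> nu mt lt; have t1 := min_bad_lone_gt1 mt lt; have [_ /(_ t) utm _] := normalP _ _ nu.
by case: m nu utm => [|m] nu utm; [lia|apply: face_normal => //; lia].
Qed.

Lemma collapse_loneN m u t : normal m.+1 u -> min_bad u t -> lone u t ->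
  ~~ lone (collapse m u t) t.
Proof.
move=> nu mt lt; have t1 := min_bad_lone_gt1 mt lt.
have [_ um us] := normalP _ _ nu; have utm := um t.
have [w uw] : exists w, u w = (u t).-1 by apply: us; lia.
apply/negP=> /loneP/(_ w); rewrite !ffunE uw /face_label => h.
have wt : w = t by apply: h; repeat case: ifP; lia.
by rewrite wt in uw; lia.
Qed.

Lemma collapse_inj m u1 u2 t1 t2 : normal m.+1 u1 -> normal m.+1 u2 ->
  min_bad u1 t1 -> lone u1 t1 -> min_bad u2 t2 -> lone u2 t2 ->
  collapse m u1 t1 = collapse m u2 t2 -> u1 = u2.
Proof.
move=> n1 n2 m1 l1 m2 l2 e.
have t12 : t1 = t2.
  by apply: (min_bad_inj (collapse_min_bad n1 m1 l1)); rewrite e collapse_min_bad.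
rewrite -{}t12 in m2 l2 e; have [_ b1 _] := normalP _ _ n1; have [_ b2 _] := normalP _ _ n2.
have g1 := min_bad_lone_gt1 m1 l1; have g2 := min_bad_lone_gt1 m2 l2.
move/ffunP: e => e.
have et : u1 t1 = u2 t1 :> nat.
  by have := e t1; rewrite !ffunE /face_label; have := b1 t1; have := b2 t1; repeat case: ifP; lia.
apply/ffunP=> v; have [->//|/eqP vt] := eqVneq v t1.
have v1 : u1 v != u2 t1 by rewrite -et; apply: contra_not_neq vt => /(loneP _ _ l1).
have v2 : u2 v != u2 t1 by apply: contra_not_neq vt => /(loneP _ _ l2).
have : collapse m u1 t1 v = collapse m u2 t1 v :> nat := e v.
rewrite !ffunE /face_label et; have := b1 v; have := b2 v; have := b2 t1.
move: (u1 v) (u2 v) (u2 t1) v1 v2 g2 => a b c.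
by repeat case: ifP; lia.
Qed.

Lemma collapse_onto m l t : normal m.+1 l -> min_bad l t -> ~~ lone l t ->
  exists u, [/\ normal m.+2 u, min_bad u t, lone u t & collapse m.+1 u t = l].
Proof.
move=> nl /min_badP[bt ht] lt; have [l0 lm ls] := normalP _ _ nl.
have [t0 [v [tv v0 vt]]] := badP _ _ bt.
pose u : labelling := [ffun w => if (l t < l w) || (w == t) then (l w).+1 else l w].
have ut : u t = (l t).+1 by rewrite ffunE eqxx orbT.
have uN w : w != t -> u w = if l t < l w then (l w).+1 else l w.
  by move/negPf=> wt; rewrite ffunE wt orbF.
have vNt : v != t by rewrite -(inj_eq val_inj) /=; lia.
have [w [lw wt]] : exists w, l w = l t /\ w != t.
  by have [w] := forallPn lt; rewrite negb_imply => /andP[/eqP lw wt]; exists w.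
have nu : normal m.+2 u.
  apply/normalP; split=> [|x|i im].
  - rewrite uN ?l0 //; apply: contra t0 => /eqP<-; exact/eqP.
  - by rewrite ffunE; have := lm x; case: ifP; lia.
  case: (ltngtP i (l t).+1) => [it|it|->]; last by exists t.
    have [x xi] : exists x, l x = i by apply: ls; have := lm t; lia.
    have [xt|xt] := eqVneq x t; last by exists x; rewrite uN // xi; case: ifP; lia.
    by exists w; rewrite uN // -xi xt lw ltnn.
  have [x xi] : exists x, l x = i.-1 by apply: ls; lia.
  have xt : x != t by apply: contraTneq it => <-; lia.
  by exists x; rewrite uN // xi; case: ifP; lia.
exists u; split=> //.
- apply/min_badP; split.
    by apply/badP; rewrite ut; split=> //; exists v; rewrite uN //; split=> //; case: ifP; lia.
  move=> x xt; apply: contra (ht x xt) => /badP[x0 [y [xy y0 yx]]].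
  have xNt : x != t by rewrite -(inj_eq val_inj) /=; lia.
  apply/badP; split; first by move: x0; rewrite uN //; case: ifP; lia.
  exists y; split=> //; first by move: y0; rewrite /u ffunE; case: ifP => //; case: eqP => [->|]; lia.
  by move: yx; rewrite (uN x) // /u ffunE; repeat case: ifP; case: eqP => [->|]; lia.
- apply/loneP=> x; rewrite ut; have [//|xt] := eqVneq x t.
  by rewrite uN //; case: ifP; lia.
apply/ffunP=> x; rewrite /collapse ut ffunE /face_label /=; have := lm t; have := lm x.
have [->|xt] := eqVneq x t; first by rewrite ut; repeat case: ifP; lia.
by rewrite uN //; repeat case: ifP; lia.
Qed.

Definition zeros f := #|[set v | f v == 0]|.

Definition key f : V := odflt ord0 [pick t | min_bad f t].

Lemma keyE f t : min_bad f t -> key f = t.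
Proof.
by rewrite /key; case: pickP => [s ms mt|->//]; rewrite (min_bad_inj ms mt).
Qed.

(* The lexicographic order on (number of zeros, - first bad vertex, its label). *)
Definition weight m f :=
  (zeros f * n.+2 + (n.+1 - key f)) * m + f (key f).

Lemma zeros_inner_face m i u : normal m.+1 u -> 0 < i < m ->
  zeros (face m i u) = zeros u.
Proof.
case/normalP=> _ um _ im; apply: eq_card => v; rewrite !inE ffunE /face_label.
by have := um v; repeat case: ifP; lia.
Qed.

Lemma zeros_outer_face m i u : normal m.+1 u -> 0 < m -> i = 0 \/ i = m ->
  zeros u < zeros (face m i u).
Proof.
case/normalP=> u0 um us m0 im; apply: proper_card; apply/properP; split.
  apply/subsetP=> v; rewrite !inE ffunE => /eqP->; rewrite /face_label.
  by repeat case: ifP; lia.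
have [w uw] : exists w, u w = if i == m then m else 1 by apply: us; case: ifP; lia.
by exists w; rewrite !inE ?ffunE uw /face_label; repeat case: ifP; lia.
Qed.

Lemma weight_face m i u t s : normal m.+1 u -> min_bad u t -> lone u t -> i <= m ->
  min_bad (face m i u) s -> ~~ lone (face m i u) s -> i != (u t).-1 ->
  weight m (collapse m u t) < weight m (face m i u).
Proof.
move=> nu mt lt im ms ls it; have t1 := min_bad_lone_gt1 mt lt.
have [_ um _] := normalP _ _ nu; have utm := um t.
rewrite /weight (keyE ms) (keyE (collapse_min_bad nu mt lt)) [zeros (collapse _ _ _)]zeros_inner_face //; last lia.
have ct : collapse m u t t < m by rewrite ffunE /face_label; repeat case: ifP; lia.
have lexico x y a b : x < y -> a < m -> x * m + a < y * m + b by nia.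
have [i0m|i0m] := boolP ((i == 0) || (i == m)).
  apply: lexico => //; have : zeros u < zeros (face m i u).
    by apply: zeros_outer_face => //; [lia|case/orP: i0m => /eqP; [left|right]].
  by have := ltn_ord t; move: (nat_of_ord t) (nat_of_ord s) => a b; nia.
have [bt _] := min_badP _ _ mt.
have i0 : 0 < i < m by lia.
rewrite zeros_inner_face //.
have [s' s't ms'] := bad_min_bad (bad_face nu i0 bt).
rewrite -{s' ms'}(min_bad_inj ms ms') in s't.
move: s't; rewrite leq_eqVlt => /orP[/eqP/val_inj st|st]; last first.
  by apply: lexico => //; rewrite ltn_add2l; have := ltn_ord t; move: (nat_of_ord t) (nat_of_ord s) st => a b; lia.
rewrite {}st in ms ls *; rewrite ltn_add2l.
have [w [lw wt]] : exists w, face m i u w = face m i u t /\ w != t.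
  by have [w] := forallPn ls; rewrite negb_imply => /andP[/eqP lw wt]; exists w.
have wtN : u w <> u t by move/(loneP _ _ lt)/eqP; rewrite (negPf wt).
have := um w; move: lw; rewrite !ffunE /face_label; repeat case: ifP; lia.
Qed.

End Matching.

Section Dimension.
Variable F : fieldType.

Lemma dim_ffun (X : finType) : \dim (fullv : {vspace {ffun X -> F^o}}) = #|X|.
Proof. by rewrite dimvf /dim /= muln1. Qed.

Lemma dim_le_coord (X : finType) (W : {vspace {ffun X -> F^o}}) (P : pred X) :
  (forall c, c \in W -> (forall x, P x -> c x = 0) -> c = 0) -> (\dim W <= #|P|)%N.
Proof.
move=> h; pose r (c : {ffun X -> F^o}) : {ffun {x | P x} -> F^o} := [ffun y => c (val y)].
have rL : linear r by move=> a c d; apply/ffunP=> y; rewrite !ffunE.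
pose rM := GRing.isLinear.Build _ _ _ _ r rL.
pose rl : {linear _ -> _} := HB.pack r rM.
have WK : (W :&: lker (linfun rl) = 0)%VS.
  apply/eqP; rewrite -subv0; apply/subvP=> c; rewrite memv_cap memv_ker lfunE /= memv0.
  case/andP=> cW /eqP/ffunP c0; apply/eqP/h => // x Px.
  by have := c0 (exist _ x Px); rewrite !ffunE.
have := limg_ker_dim (linfun rl) W; rewrite WK dimv0 add0n => <-.
by rewrite (leq_trans (dimvS (subvf _))) // dim_ffun card_sig.
Qed.

Lemma dim_ge_family (vT : vectType F) (I : finType) (e : I -> vT) (W : {vspace vT}) :
  (forall i, e i \in W) ->
  (forall a : I -> F, \sum_i a i *: e i = 0 -> forall i, a i = 0) -> (#|I| <= \dim W)%N.
Proof.
move=> eW efree; pose X := [tuple e (enum_val i) | i < #|I|].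
have /eqP fX : free X.
  apply/freeP=> k k0 i; rewrite -[i]enum_valK; apply: (efree (k \o enum_rank)).
  rewrite -{}[RHS]k0 (reindex_onto enum_val enum_rank) => [|i' _]; last exact: enum_rankK.
  apply: eq_big => [j|j _]; first by rewrite enum_valK eqxx.
  by rewrite /= enum_valK (nth_map j) ?size_enum_ord // nth_ord_enum.
rewrite size_tuple in fX; rewrite -{}fX; apply: dimvS; apply/span_subvP=> v.
by case/mapP=> i _ ->.
Qed.

End Dimension.

Section Rank.
Variables (F : fieldType) (n : nat).

Lemma upper_inj m (c : chain F n.+1 m.+1) :
  (forall x, ~~ upper (block_label x) -> c x = 0) ->
  (forall y : cbasis n.+1 m, lower (block_label y) -> bd F n.+1 m c y = 0) -> c = 0.
Proof.
move=> cU cL; apply/ffunP=> x0; rewrite ffunE; apply/eqP/negP=> /negP nx0.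
pose mu (x : cbasis n.+1 m.+1) := collapse m (block_label x) (key (block_label x)).
have [x /= nx xmin] := arg_minnP (fun x => weight m (mu x)) (nx0 : (fun x => c x != 0) x0).
have /existsP[t /andP[mt lt]] : upper (block_label x).
  by apply: contraNT nx => /cU->.
have nlx := block_label_normal x; have kt := keyE mt.
have ncx : normal m (mu x) by rewrite /mu kt collapse_normal.
have [y ly] := block_label_onto ncx.
have := cL y; rewrite ly => cy.
have {cy} : bd F n.+1 m c y = 0.
  by apply: cy; apply/existsP; exists t; rewrite /mu kt collapse_min_bad ?collapse_loneN.
rewrite bd_coef (bigD1 x) //= [X in _ + X]big1 ?addr0; last first.
  move=> x' xx'; have [->|nx'] := eqVneq (c x') 0; first by rewrite mul0r.
  rewrite big1 ?mulr0 // => i _; case: eqP => [e|]; last by rewrite mulr0.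
  have /existsP[t' /andP[mt' lt']] : upper (block_label x').
    by apply: contraNT nx' => /cU->.
  have nlx' := block_label_normal x'.
  have := xmin x' nx'; rewrite leqNgt => /negP[].
  rewrite /mu (keyE mt') -/(mu x) -ly e.
  apply: (weight_face (s := t)) => //; rewrite -?e ?ly /mu ?kt ?collapse_min_bad ?collapse_loneN //.
    by rewrite -ltnS.
  apply/eqP=> it; case/eqP: xx'; apply: block_label_inj.
  apply: (collapse_inj nlx' nlx mt' lt' mt lt).
  by rewrite /collapse -it -e ly /mu kt.
have [_ /(_ t) xm _] := normalP _ _ nlx.
have jm : ((block_label x t).-1 < m.+1)%N by lia.
rewrite (bigD1 (Ordinal jm)) //= big1 ?addr0; last first.
  move=> i ij; case: eqP => [e|]; last by rewrite mulr0.
  have : (weight m (mu x) < weight m (block_label y))%N.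
    rewrite {1}/mu kt e; apply: (weight_face (s := t)) => //;
      rewrite -?e ?ly /mu ?kt ?collapse_min_bad ?collapse_loneN //.
    by rewrite -ltnS.
  by rewrite ly ltnn.
rewrite ly /mu kt eqxx mulr1 => /eqP; rewrite mulf_eq0 signr_eq0 orbF.
by rewrite (negPf nx).
Qed.

Definition uppers m := [pred x : cbasis n.+1 m | upper (block_label x)].
Definition lowers m := [pred x : cbasis n.+1 m | lower (block_label x)].
Definition criticals m := [pred x : cbasis n.+1 m | critical (block_label x)].

Lemma card_cells m : #|{: cbasis n.+1 m}| = (#|uppers m| + (#|lowers m| + #|criticals m|))%N.
Proof.
rewrite -(cardC (uppers m)) -(cardID (lowers m) [predC uppers m]); congr (_ + (_ + _))%N.
  apply: eq_card => x; rewrite !inE andbC.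
  by case: (boolP (upper _)) => [/upper_lowerN/negPf->|] /=; rewrite ?andbT ?andbF.
apply: eq_card => x; rewrite !inE -[critical _]negbK criticalN negb_or.
by rewrite andbC.
Qed.

Lemma card_lowers m : #|lowers m.+1| = #|uppers m.+2|.
Proof.
have mu_ex (x : cbasis n.+1 m.+2) : exists y : cbasis n.+1 m.+1, upper (block_label x) ==>
    (block_label y == collapse m.+1 (block_label x) (key (block_label x))).
  case: (boolP (upper _)) => [/existsP[t /andP[mt lt]]|_].
    have [y yE] := block_label_onto (collapse_normal (block_label_normal x) mt lt).
    by exists y; rewrite yE (keyE mt) eqxx.
  have nx := block_label_normal x.
  by have [y _] := block_label_onto (face_normal nx (leq0n _)); exists y.
pose h x := xchoose (mu_ex x).
have hE x t : min_bad (block_label x) t -> lone (block_label x) t ->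
    block_label (h x) = collapse m.+1 (block_label x) t.
  move=> mt lt; have /implyP h' := xchooseP (mu_ex x); rewrite -(keyE mt).
  by apply/eqP/h'/existsP; exists t; rewrite mt.
rewrite -[RHS]cardsE -(@card_in_imset _ _ h [set x in uppers m.+2]) => [|x x']; last first.
  rewrite !inE => /existsP[t /andP[mt lt]] /existsP[t' /andP[mt' lt']] e.
  apply: block_label_inj; apply: (collapse_inj _ _ mt lt mt' lt');
    try exact: block_label_normal.
  by rewrite -(hE x) // -(hE x') // e.
apply: eq_card => y; rewrite !inE; apply/idP/imsetP => [|[x]].
  case/existsP=> t /andP[mt lt].
  have [u [nu mu lu ul]] := collapse_onto (block_label_normal y) mt lt.
  have [x xu] := block_label_onto nu; exists x.
    by rewrite !inE xu; apply/existsP; exists t; rewrite mu.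
  by apply: block_label_inj; rewrite (hE x t) ?xu.
rewrite !inE => /existsP[t /andP[mt lt]] ->; apply/existsP; exists t.
by rewrite (hE x t) // collapse_min_bad ?collapse_loneN // block_label_normal.
Qed.

End Rank.

Section Alternating.
Variables (F : fieldType) (n : nat).
Hypothesis char0 : [pchar F] =i pred0.
Local Notation V := 'I_n.+1.
Local Notation labelling := {ffun V -> nat}.

Definition swap_label i a : nat := if a == i then i.+1 else if a == i.+1 then i else a.

Definition swap i m (x : cbasis n.+1 m) : cbasis n.+1 m :=
  odflt x [pick y : cbasis n.+1 m |
    block_label y == [ffun v => swap_label i (block_label x v)] :> labelling].

Lemma swap_labelE m i (x : cbasis n.+1 m.+1) v : (0 < i < m)%N ->
  block_label (swap i x) v = swap_label i (block_label x v).
Proof.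
move=> im; have [x0 xm xs] := normalP _ _ (block_label_normal x).
have : normal m.+1 ([ffun v => swap_label i (block_label x v)] : labelling).
  apply/normalP; split=> [|w|j jm]; first by rewrite ffunE x0 /swap_label; repeat case: ifP; lia.
    by rewrite ffunE /swap_label; have := xm w; repeat case: ifP; lia.
  have [w xw] : exists w, block_label x w = swap_label i j.
    by apply: xs; rewrite /swap_label; repeat case: ifP; lia.
  by exists w; rewrite ffunE xw /swap_label; repeat case: ifP; lia.
case/block_label_onto=> y yE; rewrite /swap; case: pickP => [z /eqP->|/(_ y)].
  by rewrite ffunE.
by rewrite yE eqxx.
Qed.

Lemma swap_labelK i : involutive (swap_label i).
Proof. by move=> a; rewrite /swap_label; repeat case: ifP; lia. Qed.

Lemma swapK m i : (0 < i < m)%N -> involutive (@swap i m.+1).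
Proof.
move=> im x; apply: block_label_inj; apply/ffunP=> v.
by rewrite !swap_labelE // swap_labelK.
Qed.

(* Effect on labels of moving the block 1 just behind the block j. *)
Definition move_label j a : nat :=
  if a == 0%N then 0%N else if a == 1%N then j else if (a <= j)%N then a.-1 else a.

Fixpoint move k m (x : cbasis n.+1 m) : cbasis n.+1 m :=
  if k is k'.+1 then swap k (move k' x) else x.

Lemma move_labelE m k (x : cbasis n.+1 m.+1) v : (k < m)%N ->
  block_label (move k x) v = move_label k.+1 (block_label x v).
Proof.
elim: k => [|k IH] km; first by rewrite /= /move_label; repeat case: ifP; lia.
rewrite /= swap_labelE ?IH; [|lia|lia].
rewrite /swap_label /move_label; move: (block_label x v) => a.
by case: (a =P 0%N) => ? /=; case: (a =P 1%N) => ? /=; case: (leqP a k.+1) => ? /=;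
  repeat case: ifP; lia.
Qed.

Lemma move_inj m k : (k < m)%N -> injective (@move k m.+1).
Proof.
elim: k => [|k IH] km; first exact: inj_id.
by move=> x y /= /(can_inj (@swapK m k.+1 km)) /IH; apply; lia.
Qed.

Definition alternating m (c : chain F n.+1 m.+1) :=
  forall i x, (0 < i < m)%N -> c (swap i x) = - c x.

Lemma alternating_move m k (c : chain F n.+1 m.+1) x : alternating c -> (k < m)%N ->
  c (move k x) = (-1) ^+ k * c x.
Proof.
move=> ca; elim: k => [|k IH] km; first by rewrite mul1r.
by rewrite /= ca // IH 1?ltnW // exprS mulN1r mulNr.
Qed.

Lemma eq_opp0 (a : F) : a = - a -> a = 0.
Proof.
move/eqP; rewrite -addr_eq0 -mulr2n -mulr_natr mulf_eq0 => /orP[/eqP//|].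
by have /pcharf0P -> := char0.
Qed.

Lemma alternating_cycle m (c : chain F n.+1 m.+1) : alternating c -> bd F n.+1 m c = 0.
Proof.
case: m c => [|m] c ca; first exact: chain0_eq0.
apply/ffunP=> y; rewrite bd_coef ffunE.
pose s i := \sum_x c x * (block_label y == face m.+1 i (block_label x))%:R.
have -> : \sum_x c x * (\sum_(i < m.+2) (-1) ^+ i *
     (block_label y == face m.+1 i (block_label x))%:R) = \sum_(i < m.+2) (-1) ^+ i * s i.
  under eq_bigr => x _ do rewrite mulr_sumr.
  rewrite exchange_big; apply: eq_bigr => i _; rewrite mulr_sumr; apply: eq_bigr => x _.
  by rewrite mulrCA.
have s0 i : (0 < i < m.+1)%N -> s i = 0.
  move=> im; apply: eq_opp0; rewrite /s {1}(reindex_inj (can_inj (@swapK m.+1 i im))) -sumrN.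
  apply: eq_bigr => x _; rewrite ca // mulNr; congr (- (_ * (_ == _)%:R)); apply/ffunP=> v.
  by rewrite !faceE swap_labelE // /swap_label /face_label; repeat case: ifP; lia.
have sm : s m.+1 = (-1) ^+ m * s 0%N.
  rewrite /s (reindex_inj (@move_inj m.+1 m (ltnSn m))) mulr_sumr; apply: eq_bigr => x _.
  rewrite alternating_move // mulrA; congr (_ * (_ == _)%:R); apply/ffunP=> v.
  have [_ /(_ v) xm _] := normalP _ _ (block_label_normal x).
  rewrite !faceE move_labelE // /move_label /face_label; move: (block_label x v) xm => a am.
  by case: (a =P 0%N) => ? /=; case: (a =P 1%N) => ? /=;
    case: (leqP a m.+1) => ? /=; repeat case: ifP; lia.
rewrite big_ord_recl big_ord_recr /= big1 => [|i _]; last by rewrite s0 ?mulr0 // /bump /= add1n ltnS ltn_ord.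
rewrite add0r mul1r sm mulrA -exprD; have -> : (bump 0 m + m = (m + m).+1)%N by [].
by rewrite exprS mulN1r -signr_odd oddD addbb mulN1r subrr.
Qed.

Definition det_chain m (s : 'I_m -> V) (P : pred labelling) : chain F n.+1 m.+1 :=
  [ffun x => if P (block_label x)
     then \det (\matrix_(i < m, j < m) (block_label x (s i) == j.+1)%:R) else 0].

Lemma det_chain_alternating m (s : 'I_m -> V) (P : pred labelling) :
  (forall i x, (0 < i < m)%N ->
     P (block_label (swap i x : cbasis n.+1 m.+1)) = P (block_label x)) ->
  alternating (det_chain s P).
Proof.
move=> Ps i x im; rewrite !ffunE Ps //; case: ifP => _; last by rewrite oppr0.
have i1 : (i.-1 < m)%N by lia.
have i2 : (i < m)%N by lia.
set A := (X in - \det X).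
have -> : \matrix_(k < m, j < m) (block_label (swap i x) (s k) == j.+1)%:R
    = xcol (Ordinal i1) (Ordinal i2) A :> 'M[F]_m.
  apply/matrixP=> k j; rewrite !mxE swap_labelE // (inv_eq (@swap_labelK i)).
  congr (_ == _)%:R; rewrite /swap_label.
  case: tpermP => [->|->|/eqP + /eqP]; rewrite -?(inj_eq val_inj) /=;
    by repeat case: ifP; lia.
rewrite xcolE det_mulmx /tperm_mx det_perm odd_tperm.
by rewrite -(inj_eq val_inj) /= (_ : i.-1 != i) ?mulrN1 //; lia.
Qed.

End Alternating.

Section StandardCells.
Local Open Scope nat_scope.
Variable n : nat.
Local Notation V := 'I_n.+1.
Local Notation labelling := {ffun V -> nat}.
Implicit Types (f g : labelling) (S : {set V}) (v w : V).

(* For a set S of vertices, the partition into the singletons of S and the    *)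
(* complement of S is encoded by representatives: the complement is           *)
(* represented by its hub, which is vertex 0 whenever possible.               *)
Definition hub S : V := if ord0 \in S then odflt ord0 [pick v in ~: S] else ord0.

Definition rep S v : V := if v \in S then v else hub S.

Definition verts S : seq V := [seq v <- hub S :: enum S | v != ord0].

Definition std S : labelling := [ffun v => index (rep S v) (ord0 :: verts S)].

Lemma hub_notin S : #|S| <= n -> hub S \notin S.
Proof.
move=> Sn; rewrite /hub; case: ifP => [_|->//]; case: pickP => [v|]; first by rewrite inE.
move=> Sfull; have : #|~: S| = 0 by apply: eq_card0.
by have := cardsC S; rewrite card_ord; lia.
Qed.

Lemma rep_notin S v : v \notin S -> rep S v = hub S.
Proof. by rewrite /rep => /negPf->. Qed.

Lemma mem_reps S v : (v \in ord0 :: verts S) = (v \in hub S |: S).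
Proof.
rewrite inE mem_filter inE mem_enum !inE; have [->|//] := eqVneq v ord0.
by rewrite /hub; case: ifP => //=; rewrite ?eqxx ?orbT // => ->; rewrite orbT.
Qed.

Lemma rep_in S v : rep S v \in ord0 :: verts S.
Proof. by rewrite mem_reps /rep; case: ifP => vS; rewrite !inE ?eqxx // vS orbT. Qed.

Lemma rep_id S v : v \in ord0 :: verts S -> rep S v = v.
Proof. by rewrite mem_reps !inE /rep; case: ifP => // _ /orP[/eqP|]. Qed.

Lemma uniq_reps S : #|S| <= n -> uniq (ord0 :: verts S).
Proof.
move=> Sn; rewrite cons_uniq mem_filter eqxx filter_uniq //= mem_enum enum_uniq andbT.
exact: hub_notin.
Qed.

Lemma size_verts S : #|S| <= n -> size (verts S) = #|S|.
Proof.
move=> Sn; apply: succn_inj; rewrite -[LHS]/(size (ord0 :: verts S)).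
rewrite -(card_uniqP (uniq_reps Sn)) (eq_card (mem_reps S)) cardsU1.
by rewrite hub_notin.
Qed.

Lemma std_normal S : #|S| <= n -> normal #|S|.+1 (std S).
Proof.
move=> Sn; apply/normalP; split=> [|v|i iS].
- by rewrite ffunE rep_id ?inE ?eqxx //= eqxx.
- by rewrite ffunE -(size_verts Sn) -[X in _ < X]/(size (ord0 :: verts S)) index_mem rep_in.
exists (nth ord0 (ord0 :: verts S) i).
have si : i < size (ord0 :: verts S) by rewrite /= size_verts.
by rewrite ffunE rep_id ?mem_nth // index_uniq // uniq_reps.
Qed.

Lemma std_nth S i : #|S| <= n -> i < #|S| -> std S (nth ord0 (verts S) i) = i.+1.
Proof.
move=> Sn iS; have si : i < size (verts S) by rewrite size_verts.
rewrite ffunE rep_id; last by rewrite inE mem_nth ?orbT.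
by rewrite -[nth _ _ _]/(nth ord0 (ord0 :: verts S) i.+1) index_uniq // uniq_reps.
Qed.

Lemma sorted_enum_set S : sorted (relpre val ltn) (enum S).
Proof.
rewrite {1}/enum_mem; apply: sorted_filter; first by move=> x y z; apply: ltn_trans.
by rewrite -enumT -sorted_map val_enum_ord iota_ltn_sorted.
Qed.

Definition const_off S f := [forall v, forall w, (v \notin S) && (w \notin S) ==> (f v == f w)].

Lemma const_offP S f :
  reflect (forall v w, v \notin S -> w \notin S -> f v = f w) (const_off S f).
Proof.
apply: (iffP 'forall_forallP) => h v w; last by apply/implyP=> /andP[vS wS]; apply/eqP/h.
by move=> vS wS; apply/eqP; have /implyP := h v w; apply; rewrite vS.
Qed.

Lemma std_const_off S : const_off S (std S).
Proof. by apply/const_offP=> v w vS wS; rewrite !ffunE !rep_notin. Qed.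

Definition support f : {set V} := [set v | f v != 0].

Lemma criticalP f : critical f -> forall v w, v < w -> f v != 0 -> f w != 0 -> f v < f w.
Proof.
move/forallP=> cf v w vw v0 w0; rewrite ltnNge; apply: contra (cf v) => wv.
by apply/badP; split=> //; exists w.
Qed.

Lemma critical_inj_in f v w : critical f -> f v != 0 -> f v = f w -> v = w.
Proof.
move=> cf v0 vw; have w0 : f w != 0 by rewrite -vw.
case: (ltngtP v w) => [lt|lt|/val_inj //].
  by have := criticalP cf lt v0 w0; rewrite vw ltnn.
by have := criticalP cf lt w0 v0; rewrite vw ltnn.
Qed.

Lemma card_support m f : normal m.+1 f -> critical f -> #|support f| = m.
Proof.
case/normalP=> f0 fm fs cf; pose h v : 'I_m.+1 := inord (f v).
have hE v : h v = f v :> nat by rewrite inordK.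
rewrite -(@card_in_imset _ _ h) => [|v w]; last first.
  rewrite !inE => v0 _ /(congr1 val); rewrite /= !hE; exact: critical_inj_in.
have mE : m = #|[set~ (ord0 : 'I_m.+1)]| by rewrite cardsC1 card_ord.
apply: etrans (esym mE); apply: eq_card => i; rewrite !inE.
apply/imsetP/idP => [[v]|i0]; first by rewrite inE => v0 ->; rewrite -(inj_eq val_inj) /= hE.
have [v vi] := fs i (ltn_ord i); exists v; last by apply/val_inj; rewrite /= hE.
by rewrite inE vi.
Qed.

Lemma critical_eq m f g : normal m.+1 f -> normal m.+1 g -> critical f -> critical g ->
  support f = support g -> f = g.
Proof.
move=> nf ng cf cg sfg; apply/ffunP=> v0; apply/eqP; apply: contraT => ne0.
have [v /= ne vmin] := arg_minnP (fun v : V => v : nat) (ne0 : (fun v => f v != g v) v0).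
have eq_lt w : w < v -> f w = g w.
  by move=> wv; apply/eqP; apply: contraTT wv => /vmin; rewrite -leqNgt.
have vs : (f v != 0) = (g v != 0) by have /setP/(_ v) := sfg; rewrite !inE.
wlog lt : f g nf ng cf cg sfg {ne0 vmin} ne eq_lt vs / f v < g v => [th|].
  case: (ltngtP (f v) (g v)) ne => // lt _; first by apply: (th f g) => //; rewrite ltn_eqF.
  by apply: (th g f) => //; [rewrite ltn_eqF|move=> w /eq_lt].
have [_ fm _] := normalP _ _ nf; have [_ _ gs] := normalP _ _ ng.
have [w gw] := gs (f v) (fm v).
have f0 : f v != 0 by rewrite vs; lia.
have wv : w < v.
  rewrite ltnNge; apply/negP; rewrite leq_eqVlt => /orP[/eqP/val_inj e|vw].
    by move: lt; rewrite -gw e ltnn.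
  have := criticalP cg vw; rewrite gw -vs f0 => /(_ isT isT); lia.
have := eq_lt w wv; rewrite gw => /esym/(critical_inj_in cf f0) e.
by rewrite e ltnn in wv.
Qed.

Section Avoiding0.
Variables (S : {set V}) (S0 : ord0 \notin S).

Lemma verts_avoid0 : verts S = enum S.
Proof.
rewrite /verts /hub (negPf S0) /=; apply/all_filterP/allP=> v.
by rewrite mem_enum; apply: contraTneq => ->.
Qed.

Lemma std_avoid0 v : std S v = if v \in S then (index v (enum S)).+1 else 0.
Proof.
rewrite ffunE verts_avoid0 /rep /hub (negPf S0); case: (boolP (v \in S)) => // vS /=.
by rewrite ifN //; apply: contraTneq vS => <-.
Qed.

Lemma support_std : support (std S) = S.
Proof. by apply/setP=> v; rewrite inE std_avoid0; case: ifP. Qed.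

Lemma card_avoid0 : #|S| <= n.
Proof.
have : S \subset [set~ ord0] by apply/subsetP=> v vS; rewrite !inE; apply: contraNneq S0 => <-.
by move/subset_leq_card; rewrite cardsC1 card_ord.
Qed.

Lemma std_critical : critical (std S).
Proof.
apply/forallP=> t; apply/negP=> /badP[]; rewrite std_avoid0; case: ifP => // tS _ [v [tv]].
rewrite std_avoid0; case: ifP => // vS _ vt.
have : index v (enum S) < index t (enum S).
  rewrite ltn_neqAle -ltnS vt andbT; apply: contraTneq tv => /(congr1 (nth ord0 (enum S))).
  by rewrite !nth_index ?mem_enum // => ->; rewrite ltnn.
have st := sorted_enum_set S.
have tr : transitive (relpre val ltn : rel V) by move=> x y z; apply: ltn_trans.
have vE : v \in enum S by rewrite mem_enum.
have tE : t \in enum S by rewrite mem_enum.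
move/(sorted_ltn_index tr st v t vE tE) => /= vt'.
by have := ltn_trans tv vt'; rewrite ltnn.
Qed.

End Avoiding0.

Lemma critical_std m f : normal m.+1 f -> critical f -> f = std (support f).
Proof.
move=> nf cf; have [f0 _ _] := normalP _ _ nf.
have S0 : ord0 \notin support f by rewrite inE f0.
apply: (critical_eq nf _ cf (std_critical S0)); last by rewrite support_std.
by rewrite -{1}(card_support nf cf) std_normal // card_avoid0.
Qed.

Lemma card_criticals m : #|criticals n m.+1| = 'C(n, m).
Proof.
pose A := [set S : {set V} | (S \subset [set~ ord0]) && (#|S| == m)].
have -> : 'C(n, m) = #|A| by rewrite cards_draws cardsC1 card_ord.
pose h (x : cbasis n.+1 m.+1) := support (block_label x).
have hx x : x \in criticals n m.+1 -> block_label x = std (h x).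
  by rewrite inE => /(critical_std (block_label_normal x)).
rewrite -(@card_in_imset _ _ h) => [|x y]; last first.
  by move=> cx cy e; apply: block_label_inj; rewrite (hx x cx) (hx y cy) e.
apply: eq_card => S; rewrite /A [RHS]in_set; apply/imsetP/andP => [[x]|[S0 /eqP Sm]].
  rewrite inE => cx ->; rewrite (card_support (block_label_normal x)) //.
  split=> //; apply/subsetP=> v; rewrite !inE; apply: contraNneq => ->.
  by have [->] := normalP _ _ (block_label_normal x).
have {}S0 : ord0 \notin S by apply: contraTN isT => /(subsetP S0); rewrite !inE eqxx.
have := std_normal (card_avoid0 S0); rewrite Sm => /block_label_onto[x xS].
exists x; first by rewrite inE xS std_critical.
by rewrite /h xS support_std.
Qed.

End StandardCells.

Section Cycles.
Variables (F : fieldType) (n : nat).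
Hypothesis char0 : [pchar F] =i pred0.
Local Notation V := 'I_n.+1.
Implicit Types S : {set V}.

Definition alt_chain m S : chain F n.+1 m.+1 :=
  det_chain F (fun i : 'I_m => nth ord0 (verts S) i) (const_off S).

Lemma alt_chain_cycle m S : bd F n.+1 m (alt_chain m S) = 0.
Proof.
apply/alternating_cycle/det_chain_alternating => // i x im.
apply/const_offP/const_offP => h v w vS wS; last by rewrite !swap_labelE // (h v w).
by have := h v w vS wS; rewrite !swap_labelE // => /(can_inj (swap_labelK i)).
Qed.

Lemma alt_chain_std m S (x : cbasis n.+1 m.+1) : (m <= n)%N -> #|S| = m ->
  block_label x = std S -> alt_chain m S x = 1.
Proof.
move=> mn Sm xS; rewrite ffunE xS std_const_off -[RHS](det1 _ m); congr (\det _).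
by apply/matrixP=> i j; rewrite !mxE std_nth ?Sm ?eqSS.
Qed.

Lemma alt_chain_neq0 m S (x : cbasis n.+1 m.+1) : (m <= n)%N -> #|S| = m ->
  alt_chain m S x != 0 ->
  const_off S (block_label x) /\ {in ord0 :: verts S &, injective (block_label x)}.
Proof.
move=> mn Sm; rewrite ffunE; case: ifP => [cS|_]; last by rewrite eqxx.
have sv : size (verts S) = m by rewrite size_verts Sm.
have vE v : v \in verts S -> exists i : 'I_m, v = nth ord0 (verts S) i.
  move=> vS; have im : (index v (verts S) < m)%N by rewrite -sv index_mem.
  by exists (Ordinal im); rewrite nth_index.
move=> det0; split=> //.
have x0 v : v \in verts S -> block_label x v != 0%N.
  move/vE=> [i ->]; apply: contraNneq det0 => xi; rewrite (expand_det_row _ i) big1 // => j _.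
  by rewrite mxE xi mul0r.
have [b0 _ _] := normalP _ _ (block_label_normal x).
move=> v w; rewrite !inE => /predU1P[->|vS] /predU1P[->|wS] //.
- by move=> e; have := x0 w wS; rewrite -e b0.
- by move=> e; have := x0 v vS; rewrite e b0.
have [[i ->] [j ->]] := (vE v vS, vE w wS) => xij.
have [->//|ij] := eqVneq i j.
case/eqP: det0; apply: (determinant_alternate ij) => k.
by rewrite !mxE xij.
Qed.

Lemma alt_chain_lower m S (x : cbasis n.+1 m.+1) : ord0 \notin S -> #|S| = m ->
  lower (block_label x) -> alt_chain m S x = 0.
Proof.
move=> S0 Sm /existsP[t /andP[/min_badP[/badP[t0 _] _] /forallPn[w]]].
rewrite negb_imply => /andP[/eqP wt wNt]; apply/eqP/negPn/negP.
have mn : (m <= n)%N by rewrite -Sm card_avoid0.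
case/(alt_chain_neq0 mn Sm)=> /const_offP cS xinj; case/eqP: wNt.
have [b0 _ _] := normalP _ _ (block_label_normal x).
have inS v : block_label x v != 0%N -> v \in ord0 :: verts S.
  by move=> v0; rewrite mem_reps !inE; apply: contraNT v0 => /norP[_ vS]; rewrite (cS v ord0) ?b0.
by apply: xinj; rewrite ?inS ?wt.
Qed.

Lemma alt_chain_critical m S (x : cbasis n.+1 m.+1) : ord0 \notin S -> #|S| = m ->
  critical (block_label x) -> alt_chain m S x = (support (block_label x) == S)%:R.
Proof.
move=> S0 Sm cx; have nx := block_label_normal x.
have mn : (m <= n)%N by rewrite -Sm card_avoid0.
case: eqP => [xS|xS].
  by rewrite (alt_chain_std mn Sm) // (critical_std nx cx) xS.
apply/eqP/negPn/negP=> /(alt_chain_neq0 mn Sm)[/const_offP cS _]; case: xS.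
apply/eqP; rewrite eqEcard (card_support nx) // Sm leqnn andbT.
have [b0 _ _] := normalP _ _ nx.
by apply/subsetP=> v; rewrite inE; apply: contraNT => vS; rewrite (cS v ord0) ?b0.
Qed.

Lemma dim_ge_cycles m (W : {vspace chain F n.+1 m.+1}) :
  (limg (bd F n.+1 m.+1) <= W)%VS ->
  (forall S, ord0 \notin S -> #|S| = m -> alt_chain m S \in W) ->
  (#|lowers n m.+1| + #|criticals n m.+1| <= \dim W)%N.
Proof.
move=> BW AW; pose I := ({x | uppers n m.+2 x} + {x | criticals n m.+1 x})%type.
pose e (i : I) := match i with
  | inl x => bd F n.+1 m.+1 (bvec F (val x))
  | inr x => alt_chain m (support (block_label (val x))) end.
have -> : (#|lowers n m.+1| + #|criticals n m.+1| = #|{: I}|)%N.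
  by rewrite card_lowers card_sum !card_sig.
have critS (x : {x | criticals n m.+1 x}) : 
    ord0 \notin support (block_label (val x)) /\ #|support (block_label (val x))| = m.
  have nx := block_label_normal (val x); have [b0 _ _] := normalP _ _ nx.
  by rewrite inE b0 (card_support nx (valP x)).
apply: (dim_ge_family (e := e)) => [[x|x]|a].
- by apply/(subvP BW)/memv_img/memvf.
- by have [S0 Sm] := critS x; apply: AW.
rewrite big_sumType /= => a0.
pose c : chain F n.+1 m.+2 := \sum_(x : {x | uppers n m.+2 x}) a (inl x) *: bvec F (val x).
have cE : \sum_(x : {x | uppers n m.+2 x}) a (inl x) *: bd F n.+1 m.+1 (bvec F (val x))
    = bd F n.+1 m.+1 c by rewrite linear_sum; apply: eq_bigr => x _; rewrite linearZ.
rewrite {}cE in a0.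
have cval x : c (val x) = a (inl x).
  rewrite sum_ffunE (bigD1 x) //= big1 ?addr0 => [|y yx].
    by rewrite !ffunE eqxx /GRing.scale /= mulr1.
  by rewrite !ffunE val_eqE eq_sym (negPf yx) scaler0.
have c0 : c = 0.
  apply: upper_inj => [x xu|y yl].
    rewrite sum_ffunE big1 // => z _; rewrite !ffunE; case: eqP => [xz|]; last by rewrite scaler0.
    by move: xu; rewrite xz (valP z : upper _).
  move/ffunP/(_ y): a0; rewrite !ffunE sum_ffunE big1 ?addr0 // => x _.
  by have [S0 Sm] := critS x; rewrite ffunE alt_chain_lower ?scaler0.
rewrite c0 linear0 add0r in a0.
case=> x; first by rewrite -cval c0 ffunE.
move/ffunP/(_ (val x)): a0; rewrite ffunE sum_ffunE (bigD1 x) //= big1 ?addr0 => [|y yx].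
  have [S0 Sm] := critS x; rewrite ffunE alt_chain_critical // ?eqxx ?(valP x) //.
  by rewrite /GRing.scale /= mulr1.
have [S0 Sm] := critS y; rewrite ffunE alt_chain_critical ?(valP x) //.
case: eqP => [xy|]; last by rewrite scaler0.
case/eqP: yx; apply/val_inj/block_label_inj.
rewrite (critical_std (block_label_normal _) (valP x)) xy.
exact: critical_std (block_label_normal _) (valP y).
Qed.

Lemma dim_cycles m : \dim (lker (bd F n.+1 m)) = (#|lowers n m.+1| + #|criticals n m.+1|)%N.
Proof.
apply/eqP; rewrite eqn_leq; apply/andP; split; last first.
  apply: dim_ge_cycles => [|S _ _]; last by rewrite memv_ker alt_chain_cycle.
  by apply/subvP=> c /memv_imgP[d _ ->]; rewrite memv_ker bd_bd.
have -> : (#|lowers n m.+1| + #|criticals n m.+1| = #|[predC uppers n m.+1]|)%N.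
  by apply/eqP; rewrite -(eqn_add2l #|uppers n m.+1|) -card_cells cardC.
apply: dim_le_coord => c; rewrite memv_ker => /eqP c0 cP; apply: upper_inj => [x xu|y _].
  by apply: cP; rewrite !inE.
by rewrite c0 ffunE.
Qed.

Lemma dim_boundaries m : \dim (limg (bd F n.+1 m)) = #|uppers n m.+1|.
Proof.
have := limg_ker_dim (bd F n.+1 m) fullv.
rewrite capfv dim_cycles dim_ffun card_cells addnC => /eqP.
by rewrite eqn_add2r => /eqP.
Qed.

End Cycles.

Section LabelArithmetic.
Local Open Scope nat_scope.
Variables (m i r s : nat).
Hypotheses (rm : r < m.+1) (sm : s < m.+1).

Lemma face_label_inner_inj : i < m -> face_label m i r = face_label m i s ->
  face_label m i r != i -> r = s.
Proof. by move=> im; rewrite /face_label (ltn_eqF im); case: (leqP r i); case: (leqP s i); lia. Qed.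

Lemma face_label_first_inj : 1 < s -> face_label m 0 r = s.-1 -> r = s.
Proof. by move=> s1; rewrite /face_label; case: (0 =P m) => ?; [lia|case: (leqP r 0); lia]. Qed.

Lemma face_label_last_inv : 1 < s -> face_label m m r = s.-1 -> r = move_label m s.
Proof. by rewrite /face_label /move_label eqxx; case: (r =P m); case: (s =P 0); case: (s =P 1); case: (leqP s m); lia. Qed.

Lemma face_label_merge : r != s -> face_label m i r = face_label m i s ->
  0 < face_label m i r -> i = face_label m i r /\ (r = i /\ s = i.+1 \/ r = i.+1 /\ s = i).
Proof.
by rewrite /face_label; case: (i =P m) => ?; 
  [case: (r =P m); case: (s =P m)|case: (leqP r i); case: (leqP s i)]; lia.
Qed.

Lemma move_label_inj : move_label m r = move_label m s -> r = s.
Proof.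
by rewrite /move_label; case: (r =P 0); case: (s =P 0) => //; case: (r =P 1); case: (s =P 1);
  case: (leqP r m); case: (leqP s m); lia.
Qed.

End LabelArithmetic.

Section Coloring.
Variables (F : fieldType) (n k : nat).
Local Notation V := 'I_n.+1.
Local Notation H := (complete_uniform n.+1 k).
Implicit Types S : {set V}.

Lemma has_edgeP m (x : cbasis n.+1 m) : (0 < k)%N ->
  reflect (exists w, (k <= #|[set v | block_label x v == block_label x w]|)%N)
    (has_edge H (val x)).
Proof.
move=> k0; have sx := size_tuple (val x).
have [_ xm _] := normalP _ _ (block_label_normal x).
have blockE w : nth set0 (val x) (block_label x w) = [set v | block_label x v == block_label x w].
  by apply/setP=> v; rewrite mem_block // inE.
apply: (iffP hasP) => [[B /(nthP set0)[j]]|[w kw]].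
  rewrite sx => jm <- /existsP[e]; rewrite inE => /andP[/eqP ek eB].
  have /card_gt0P[w we] : (0 < #|e|)%N by rewrite ek.
  have := subsetP eB w we; rewrite mem_block // => /eqP xw.
  by exists w; rewrite -blockE xw -ek subset_leq_card.
exists (nth set0 (val x) (block_label x w)); first by rewrite mem_nth ?sx.
have : (0 < #|[set e : {set V} | e \subset [set v | block_label x v == block_label x w] & #|e| == k]|)%N.
  by rewrite cards_draws bin_gt0.
case/card_gt0P=> e; rewrite inE => /andP[eB ek].
by apply/existsP; exists e; rewrite inE ek blockE.
Qed.

Lemma coloringP m (c : chain F n.+1 m) :
  reflect (forall x : cbasis n.+1 m, ~~ has_edge H (val x) -> c x = 0) (c \in coloring_complex F H m).
Proof.
rewrite -lker_qproj memv_ker lfunE; apply: (iffP eqP) => [/ffunP c0 x hx|c0].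
  by have := c0 (Sub x hx); rewrite !ffunE SubK.
by apply/ffunP=> y; rewrite !ffunE c0 // (valP y).
Qed.

Lemma card_block_le m (x : cbasis n.+1 m.+1) w :
  (m <= #|~: [set v | block_label x v == block_label x w]| ?= iff
    [forall u, forall v, (block_label x u == block_label x v) ==>
       (block_label x u != block_label x w) ==> (u == v)])%N.
Proof.
have [_ xm xs] := normalP _ _ (block_label_normal x).
pose h v : 'I_m.+1 := inord (block_label x v).
have hE v : h v = block_label x v :> nat by rewrite inordK.
set B := ~: _.
have imB : #|h @: B| = m.
  have mE : m = #|[set~ h w]| by rewrite cardsC1 card_ord.
  apply: etrans (esym mE); apply: eq_card => i.
  rewrite !inE; apply/imsetP/idP => [[v]|iw].
    by rewrite !inE => vw ->; rewrite -(inj_eq val_inj) /= !hE.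
  have [v vi] := xs i (ltn_ord i); exists v; last by apply/val_inj; rewrite /= hE.
  by move: iw; rewrite !inE vi -(inj_eq val_inj) /= hE.
split; first by rewrite -imB leq_imset_card.
rewrite -[X in X == _]imB; apply/imset_injP/'forall_forallP => [hI u v|hI u v].
  apply/implyP=> /eqP uv; apply/implyP=> uw; apply/eqP/hI; rewrite ?inE -?uv //.
  by apply/val_inj; rewrite /= !hE.
rewrite !inE => uw _ /(congr1 val); rewrite /= !hE => uv; apply/eqP.
by move/implyP: (hI u v); rewrite uv eqxx -uv => /(_ isT) /implyP; apply.
Qed.

Lemma coloring_complex0 m : (0 < k)%N -> (n.+2 < m + k)%N -> coloring_complex F H m = 0%VS.
Proof.
move=> k0 mk; apply/eqP; rewrite -subv0; apply/subvP=> c /coloringP c0; rewrite memv0.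
apply/eqP/ffunP=> x; rewrite ffunE; apply: c0; apply/negP=> /(has_edgeP _ k0)[w kw].
case: m c x mk w kw => [|m] c x mk w kw; first by have := cbasis0 x.
have [mB _] := card_block_le x w; have := cardsC [set v | block_label x v == block_label x w].
by rewrite card_ord; lia.
Qed.

Variable p : nat.
Hypotheses (pk : (p + k = n.+1)%N) (k3 : (2 < k)%N).

Definition shape S (x : cbasis n.+1 p.+1) :=
  const_off S (block_label x) /\ {in ord0 :: verts S &, injective (block_label x)}.

Lemma p_le_n : (p <= n)%N. Proof. by lia. Qed.

Lemma cardC_set S : #|S| = p -> #|~: S| = k.
Proof. by move=> Sp; have := cardsC S; rewrite card_ord; lia. Qed.

Lemma has_edge_shape (x : cbasis n.+1 p.+1) : has_edge H (val x) -> exists2 S : {set V}, #|S| = p & shape S x.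
Proof.
have k0 : (0 < k)%N by lia.
case/(has_edgeP _ k0)=> w kw; pose B := [set v | block_label x v == block_label x w].
have [mB eB] := card_block_le x w; have := cardsC B; rewrite card_ord => cB.
have Bp : #|~: B| = p by rewrite /B in cB *; lia.
exists (~: B) => //; split.
  by apply/const_offP=> u v; rewrite !inE !negbK => /eqP-> /eqP->.
have /esym : (p == #|~: B|) = true by rewrite Bp eqxx.
rewrite eB => /esym/'forall_forallP inj u v uS vS uv.
have [uw|uw] := eqVneq (block_label x u) (block_label x w); last first.
  by apply/eqP; move/implyP: (inj u v); rewrite uv eqxx -uv => /(_ isT) /implyP; apply.
have memB z : z \in ord0 :: verts (~: B) -> block_label x z = block_label x w -> z = hub (~: B).
  rewrite mem_reps !inE => /orP[/eqP//|zB zw]; by rewrite zw eqxx in zB.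
by rewrite (memB u) // (memB v) // -uv.
Qed.

Lemma const_off_has_edge S (x : cbasis n.+1 p.+1) : #|S| = p ->
  const_off S (block_label x) -> has_edge H (val x).
Proof.
move=> Sp /const_offP cS; have k0 : (0 < k)%N by lia.
have hS : hub S \notin S by rewrite hub_notin // Sp p_le_n.
apply/(has_edgeP _ k0); exists (hub S); rewrite -(cardC_set Sp).
by apply/subset_leq_card/subsetP=> v; rewrite !inE => vS; rewrite (cS v (hub S)).
Qed.

Lemma alt_chain_coloring S : #|S| = p -> alt_chain F p S \in coloring_complex F H p.+1.
Proof.
move=> Sp; apply/coloringP=> x; apply: contraNeq => /(alt_chain_neq0 p_le_n Sp)[cS _].
exact: const_off_has_edge cS.
Qed.

Lemma shape_rep S x v : #|S| = p -> shape S x -> block_label x (rep S v) = block_label x v.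
Proof.
move=> Sp [/const_offP cS _]; rewrite /rep; case: ifPn => // vS; apply: cS => //.
by rewrite hub_notin // Sp p_le_n.
Qed.

Lemma shape_single S x v w : #|S| = p -> shape S x -> v \in S ->
  block_label x w = block_label x v -> w = v.
Proof.
move=> Sp Sx vS wv; have [_ xI] := Sx.
have : rep S w = v.
  by apply: xI; rewrite ?rep_in ?shape_rep // mem_reps !inE vS orbT.
rewrite /rep; case: ifP => // _ hv.
have : hub S \notin S by rewrite hub_notin // Sp p_le_n.
by rewrite hv vS.
Qed.


Lemma face_onto m i (x : cbasis n.+1 m.+1) : (0 < m)%N -> (i <= m)%N ->
  exists y : cbasis n.+1 m, block_label y = face m i (block_label x).
Proof.
by case: m x => // m x _ im; apply/block_label_onto/face_normal/im/block_label_normal.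
Qed.

Lemma two_cofaces m (c : chain F n.+1 m.+1) (y : cbasis n.+1 m) x1 x2 i :
  bd F n.+1 m c = 0 -> (i <= m)%N -> block_label y = face m i (block_label x1) ->
  (forall x j, (j <= m)%N -> c x != 0 -> block_label y = face m j (block_label x) ->
    (x = x1 /\ j = i) \/ x = x2) ->
  c x1 != 0 -> c x2 != 0.
Proof.
move=> bdc im yx1 cof nx1; apply/eqP=> cx2; have /ffunP/(_ y) := bdc.
rewrite bd_coef ffunE (bigD1 x1) //= [X in _ + X]big1 ?addr0 => [|x xx1]; last first.
  have [->|cx] := eqVneq (c x) 0; first by rewrite mul0r.
  rewrite big1 ?mulr0 // => j _; case: eqP => [e|]; last by rewrite mulr0.
  have := cof x j (ltn_ord j) cx e; case=> [[xe _]|xe]; first by rewrite xe eqxx in xx1.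
  by rewrite xe cx2 eqxx in cx.
have im' : (i < m.+1)%N by [].
rewrite (bigD1 (Ordinal im')) //= big1 ?addr0 => [|j ji]; last first.
  case: eqP => [e|]; last by rewrite mulr0.
  have := cof x1 j (ltn_ord j) nx1 e; case=> [[_ je]|xe].
    by case/eqP: ji; apply/val_inj.
  by rewrite xe cx2 eqxx in nx1.
rewrite yx1 eqxx mulr1 => /eqP; rewrite mulf_eq0 signr_eq0 orbF.
by rewrite (negPf nx1).
Qed.

Lemma split_pair (y : cbasis n.+1 p) (x : cbasis n.+1 p.+1) j a b : a != b ->
  (forall v, block_label y v = block_label y a -> v \in [set a; b]) ->
  has_edge H (val x) -> block_label y = face p j (block_label x) ->
  block_label x a != block_label x b.
Proof.
move=> ab yab /has_edge_shape[S Sp Sx] yE; apply/eqP=> xab.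
have aS : a \notin S.
  by apply: contra ab => aS; rewrite eq_sym; apply/eqP/(shape_single Sp Sx aS).
have : ~: S \subset [set a; b].
  apply/subsetP=> v; rewrite inE => vS; apply: yab; rewrite yE !faceE.
  by have [/const_offP cS _] := Sx; rewrite (cS v a).
move/subset_leq_card; rewrite cards2 (cardC_set Sp); case: (a != b); lia.
Qed.

Section ColoringCycle.
Variable c : chain F n.+1 p.+1.
Hypotheses (c_cycle : bd F n.+1 p c = 0) (c_col : c \in coloring_complex F H p.+1).

Lemma has_edge_supp x : c x != 0 -> has_edge H (val x).
Proof. by apply: contraNT => hx; apply/eqP; move/coloringP: c_col; apply. Qed.

(* Merging two adjacent singletons a and b produces a pair, and the only      *)
(* cells of the coloring complex with this face are the two ways of splitting *)
(* it, since the big block has more than two elements.                         *)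
Lemma swap_neq0 S x a b i : #|S| = p -> shape S x -> a \in S -> b \in S ->
  (0 < i < p)%N -> block_label x a = i -> block_label x b = i.+1 ->
  c x != 0 -> c (swap i x) != 0.
Proof.
move=> Sp Sx aS bS ip xa xb.
have [|| y yE] := @face_onto p i x; [lia|lia|].
have single v : block_label x v = i \/ block_label x v = i.+1 -> v = a \/ v = b.
  by case=> xv; [left; apply: (shape_single Sp Sx aS)|right; apply: (shape_single Sp Sx bS)];
    rewrite ?xa ?xb.
have ab : a != b by apply/eqP=> e; move: xb; rewrite -e xa; lia.
have ya : block_label y a = i by rewrite yE faceE xa /face_label; repeat case: ifP; lia.
have yb : block_label y b = i by rewrite yE faceE xb /face_label; repeat case: ifP; lia.
have pair v : block_label y v = i -> v \in [set a; b].
  rewrite yE faceE => yv; rewrite !inE; apply/orP.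
  have [_ /(_ v) xm _] := normalP _ _ (block_label_normal x).
  have [] : v = a \/ v = b; [apply: single|by left; apply/eqP|by right; apply/eqP].
  by move: yv; rewrite /face_label; repeat case: ifP; lia.
apply: (two_cofaces c_cycle _ yE) => [|x' j jp /has_edge_supp hx' yE']; first lia.
have [_ x'm _] := normalP _ _ (block_label_normal x').
have [_ xm _] := normalP _ _ (block_label_normal x).
have := split_pair ab (fun v => _) hx' yE'; rewrite ya => /(_ pair) x'ab.
have ya' : face_label p j (block_label x' a) = i by rewrite -faceE -yE'.
have yb' : face_label p j (block_label x' b) = i by rewrite -faceE -yE'.
have [jy x'abi] : j = face_label p j (block_label x' a) /\
    (block_label x' a = j /\ block_label x' b = j.+1 \/
     block_label x' a = j.+1 /\ block_label x' b = j).
  by apply: face_label_merge; rewrite ?x'm ?ya' ?yb' //; case/andP: ip.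
have ji : j = i by rewrite jy ya'.
rewrite {j jy}ji in jp yE' ya' yb' x'abi *.
have rest v : v != a -> v != b -> block_label x' v = block_label x v.
  move=> va vb; apply: (@face_label_inner_inj p i); rewrite ?x'm ?xm -?faceE -?yE' ?yE //.
    by case/andP: ip.
  by rewrite -yE; apply/negP=> /eqP/pair; rewrite !inE (negPf va) (negPf vb).
case: x'abi => -[x'a x'b]; [left; split=> //|right]; apply/block_label_inj/ffunP=> v;
  (have [->|va] := eqVneq v a; last (have [->|vb] := eqVneq v b; last rewrite rest //)).
- by rewrite x'a xa.
- by rewrite x'b xb.
- by rewrite swap_labelE // xa x'a /swap_label eqxx.
- by rewrite swap_labelE // xb x'b /swap_label eqxx gtn_eqF.
rewrite swap_labelE // /swap_label; case: eqP => [xv|_].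
  by case: (single v (or_introl xv)) => e; rewrite e eqxx in va vb.
case: eqP => [xv|//].
by case: (single v (or_intror xv)) => e; rewrite e eqxx in va vb.
Qed.


Lemma move_neq0 S x b : #|S| = p -> shape S x -> ord0 \in S -> b \in S ->
  block_label x b = 1%N -> c x != 0 -> c (move p.-1 x) != 0.
Proof.
move=> Sp Sx oS bS xb.
have p0 : (0 < p)%N by rewrite -Sp; apply/card_gt0P; exists b.
have [|| y yE] := @face_onto p 0 x; [lia|lia|].
have [x0 xm _] := normalP _ _ (block_label_normal x).
have [y0 _ _] := normalP _ _ (block_label_normal y).
have single v : block_label x v = 0%N \/ block_label x v = 1%N -> v = ord0 \/ v = b.
  by case=> xv; [left; apply: (shape_single Sp Sx oS)|right; apply: (shape_single Sp Sx bS)];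
    rewrite ?x0 ?xb.
have ob : ord0 != b by apply/eqP=> e; move: xb; rewrite -e x0.
have yb : block_label y b = 0%N by rewrite yE faceE xb /face_label; repeat case: ifP; lia.
have pair v : block_label y v = 0%N -> v \in [set ord0; b].
  rewrite yE faceE => yv; rewrite !inE; apply/orP.
  have [] : v = ord0 \/ v = b; [apply: single|by left; apply/eqP|by right; apply/eqP].
  by move: yv; rewrite /face_label; have := xm v; repeat case: ifP; lia.
apply: (two_cofaces c_cycle _ yE) => [|x' j jp /has_edge_supp hx' yE']; first lia.
have [x'0 x'm _] := normalP _ _ (block_label_normal x').
have := split_pair ob (fun v => _) hx' yE'; rewrite y0 x'0 => /(_ pair) x'b0.
have yb' : face_label p j (block_label x' b) = 0%N by rewrite -faceE -yE'.
have rest v : v != ord0 -> v != b -> (1 < block_label x v)%N /\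
    face_label p j (block_label x' v) = (block_label x v).-1.
  move=> v0 vb; have yv : block_label y v != 0%N.
    by apply/negP=> /eqP/pair; rewrite !inE (negPf v0) (negPf vb).
  move: yv; rewrite -faceE -yE' yE faceE; have := xm v; rewrite /face_label.
  by repeat case: ifP; lia.
have [[j0 x'b]|[jE x'b]] : (j = 0 /\ block_label x' b = 1)%N \/ (j = p /\ block_label x' b = p)%N.
- by move: yb' x'b0; rewrite /face_label; have := x'm b; repeat case: ifP; lia.
- left; split=> //; apply/block_label_inj/ffunP=> v.
  have [->|v0] := eqVneq v ord0; first by rewrite x0 x'0.
  have [->|vb] := eqVneq v b; first by rewrite xb x'b.
  have [x1] := rest v v0 vb; rewrite j0; exact: face_label_first_inj.
right; apply/block_label_inj/ffunP=> v; rewrite move_labelE ?prednK //.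
have [->|v0] := eqVneq v ord0; first by rewrite x0 x'0.
have [->|vb] := eqVneq v b; first by rewrite xb x'b.
by have [x1] := rest v v0 vb; rewrite jE; apply: face_label_last_inv.
Qed.

Lemma shape_relabel S x x' (h : nat -> nat) : {in [pred a | (a <= p)%N] &, injective h} ->
  (forall v, block_label x' v = h (block_label x v)) -> shape S x -> shape S x'.
Proof.
move=> hI x'E [/const_offP cS xI]; split; first by apply/const_offP=> v w vS wS; rewrite !x'E (cS v w).
have [_ xm _] := normalP _ _ (block_label_normal x).
by move=> v w vS wS; rewrite !x'E => /hI e; apply: xI => //; apply: e; rewrite inE -ltnS.
Qed.

(* When vertex 0 is a singleton, moving the blocks that follow it cyclically   *)
(* to the end brings the big block to the place next to it.                    *)
Lemma hub_first S x : #|S| = p -> shape S x -> ord0 \in S -> c x != 0 ->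
  exists x', [/\ shape S x', c x' != 0 & block_label x' (hub S) = 1%N].
Proof.
move=> Sp; move hE: (block_label x (hub S)) => h; elim: h x hE => [|h IH] x hE Sx oS cx.
  have [x0 _ _] := normalP _ _ (block_label_normal x).
  have e : hub S = ord0 by apply: (shape_single Sp Sx oS); rewrite x0.
  by have := hub_notin (n := n) (S := S); rewrite Sp p_le_n e oS => /(_ isT).
have [h0|h0] := posnP h; first by exists x; rewrite hE h0.
have [x0 xm xs] := normalP _ _ (block_label_normal x).
have hp : (h < p)%N by have := xm (hub S); lia.
have [b xb] : exists b, block_label x b = 1%N by apply: xs; lia.
have bS : b \in S.
  apply/negPn/negP=> bS; have [/const_offP cS _] := Sx.
  by have := cS b (hub S) bS; rewrite hub_notin ?Sp ?p_le_n // xb hE => /(_ isT); lia.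
have cm := move_neq0 Sp Sx oS bS xb cx.
have mE v : block_label (move p.-1 x) v = move_label p (block_label x v).
  by rewrite move_labelE ?prednK; lia.
apply: (IH (move p.-1 x)) => //; first by rewrite mE hE /move_label; repeat case: ifP; lia.
by apply: (shape_relabel _ mE Sx) => r s; apply: move_label_inj.
Qed.

Definition sort_key S v : nat := if v == hub S then 0%N else (val v).+1.

Lemma sorted_verts S : #|S| = p -> sorted (relpre (sort_key S) ltn) (verts S).
Proof.
move=> Sp; have tr : transitive (relpre (sort_key S) ltn) by move=> u v w; apply: ltn_trans.
have hS : hub S \notin S by rewrite hub_notin // Sp p_le_n.
have keyS v : v \in S -> sort_key S v = (val v).+1.
  by move=> vS; rewrite /sort_key ifN //; apply: contraNneq hS => <-.
apply: sorted_filter => //=; rewrite (path_sortedE tr); apply/andP; split.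
  by apply/allP=> v; rewrite mem_enum /= => /keyS->; rewrite /sort_key eqxx.
apply: (@sub_in_sorted _ (mem S) _ _ _ _ _ (sorted_enum_set S)).
  by move=> u v uS vS; rewrite /= (keyS u uS) (keyS v vS).
by apply/allP=> v; rewrite mem_enum.
Qed.

Lemma shape_label_gt0 S x v : shape S x -> v \in verts S -> (0 < block_label x v)%N.
Proof.
move=> [_ xI] vS; rewrite lt0n; apply/eqP=> xv.
have [x0 _ _] := normalP _ _ (block_label_normal x).
have v0 : v = ord0 by apply: xI; rewrite ?inE ?eqxx ?vS ?orbT // x0.
by move: vS; rewrite v0 mem_filter eqxx.
Qed.

Lemma std_of_sorted S x : #|S| = p -> shape S x ->
  (forall v w, v \in verts S -> w \in verts S ->
    block_label x w = (block_label x v).+1 -> (sort_key S v < sort_key S w)%N) ->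
  block_label x = std S.
Proof.
move=> Sp Sx key_lt; have [_ xI] := Sx; have [x0 xm xs] := normalP _ _ (block_label_normal x).
pose u i : V := odflt ord0 [pick v | (v \in verts S) && (block_label x v == i.+1)].
have uE i : (i < p)%N -> u i \in verts S /\ block_label x (u i) = i.+1.
  move=> ip; rewrite /u; case: pickP => [v /andP[vS /eqP]//|no].
  have [v xv] := xs i.+1 ip; have := no (rep S v); rewrite shape_rep // xv eqxx andbT.
  have := rep_in S v; rewrite inE => /predU1P[r0|->//].
  by move: xv; rewrite -(shape_rep v Sp Sx) r0 x0.
have uT : mkseq u p = verts S.
  apply: (@irr_sorted_eq _ (relpre (sort_key S) ltn)) (sorted_verts Sp) _.
  - by move=> r s t; apply: ltn_trans.
  - by move=> r /=; rewrite ltnn.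
  - apply/(sortedP ord0) => i; rewrite size_mkseq => ip; rewrite !nth_mkseq ?(ltnW ip) //=.
    by have [u1 e1] := uE i (ltnW ip); have [u2 e2] := uE _ ip; apply: key_lt; rewrite ?e1.
  move=> v; apply/mapP/idP => [[i]|vS].
    by rewrite mem_iota => /andP[_ ip] ->; have [] := uE i ip.
  have v0 := shape_label_gt0 Sx vS; have vp := xm v.
  have ip : ((block_label x v).-1 < p)%N by lia.
  exists (block_label x v).-1; first by rewrite mem_iota.
  by have [u1 e1] := uE _ ip; apply: xI; rewrite ?inE ?vS ?u1 ?orbT // e1 prednK.
apply/ffunP=> v; rewrite -(shape_rep v Sp Sx) [RHS]ffunE; have := rep_in S v.
rewrite inE; case: eqVneq => [->|r0] /= rS; first by rewrite x0.
rewrite eq_sym (negPf r0) -uT in rS *; case/mapP: rS => i; rewrite mem_iota => /andP[_ ip] ri.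
have [_ e] := uE i ip; rewrite {1}ri e; congr _.+1.
rewrite -[u i in RHS](nth_mkseq ord0 u ip) in ri *; rewrite ri index_uniq ?size_mkseq // uT.
by have := @uniq_reps n S; rewrite Sp p_le_n => /(_ isT) /andP[].
Qed.

Lemma sum_swap S x v w : shape S x -> v \in verts S -> w \in verts S ->
  (block_label x v < p)%N -> block_label x w = (block_label x v).+1 ->
  (\sum_(z in verts S) block_label (swap (block_label x v) x) z * sort_key S z + sort_key S w
  = \sum_(z in verts S) block_label x z * sort_key S z + sort_key S v)%N.
Proof.
move=> Sx vS wS vp xw; have v0 := shape_label_gt0 Sx vS; have [_ xI] := Sx.
have ip : (0 < block_label x v < p)%N by rewrite v0.
have wv : w != v by apply/eqP=> e; move: xw; rewrite e; lia.
have split_sum f : (\sum_(z in verts S) f z = f v + (f w + \sum_(z in verts S | (z != v) && (z != w)) f z))%N.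
  rewrite (bigD1 v vS) [X in (_ + X)%N = _](bigD1 w) /=; last exact/andP.
  congr (_ + (_ + _))%N.
  by apply: eq_bigl => z; rewrite andbA.
rewrite !split_sum !swap_labelE // xw /swap_label eqxx gtn_eqF // eqxx.
rewrite [X in (_ + (_ + X) + _)%N](eq_bigr (fun z => block_label x z * sort_key S z)%N) => [|z /and3P[zS zv zw]].
  by rewrite !mulSn; ring.
rewrite swap_labelE // /swap_label -xw ifN ?ifN //.
  by apply: contraNneq zw => e; apply/eqP/xI; rewrite ?inE ?zS ?wS ?orbT.
by apply: contraNneq zv => e; apply/eqP/xI; rewrite ?inE ?zS ?vS ?orbT.
Qed.

Lemma cycle_std_neq0 x0 : c x0 != 0 ->
  exists S x, [/\ #|S| = p, block_label x = std S & c x != 0].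
Proof.
move=> cx0; have [S Sp Sx0] := has_edge_shape (has_edge_supp cx0).
have hS : hub S \notin S by rewrite hub_notin // Sp p_le_n.
pose Q x := [/\ shape S x, c x != 0 & ord0 \in S -> block_label x (hub S) = 1%N].
have [x Qx] : exists x, Q x.
  have [oS|oS] := boolP (ord0 \in S); last by exists x0; split=> // oS'; rewrite oS' in oS.
  by have [x [Sx cx hx]] := hub_first Sp Sx0 oS cx0; exists x.
pose W (x : cbasis n.+1 p.+1) := (\sum_(z in verts S) block_label x z * sort_key S z)%N.
pose M := (\sum_(z in verts S) p * sort_key S z)%N.
have WM y : (W y <= M)%N.
  have [_ ym _] := normalP _ _ (block_label_normal y).
  by apply: leq_sum => z _; rewrite leq_mul2r -ltnS ym orbT.
have [N] := ubnP (M - W x)%N; elim: N x Qx => // N IH x [Sx cx hx] xN.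
case: (boolP [forall v, forall w, [&& v \in verts S, w \in verts S &
    block_label x w == (block_label x v).+1] ==> (sort_key S v < sort_key S w)%N]).
  move/'forall_forallP=> sx; exists S, x; split=> //; apply: std_of_sorted => // v w vS wS xw.
  by have /implyP := sx v w; rewrite vS wS xw eqxx; apply.
case/forallPn=> v /forallPn[w]; rewrite negb_imply -leqNgt => /andP[/and3P[vS wS /eqP xw] kwv].
have [x00 xm _] := normalP _ _ (block_label_normal x); have [_ xI] := Sx.
have v0 := shape_label_gt0 Sx vS.
have wv : w != v by apply/eqP=> e; move: xw; rewrite e; lia.
have {}kwv : (sort_key S w < sort_key S v)%N.
  rewrite ltn_neqAle kwv andbT; apply: contraNneq wv; rewrite /sort_key.
  by case: (w =P hub S) => [->|_]; case: (v =P hub S) => [->|_] // [] /val_inj->.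
have vh : v != hub S by apply: contraTneq kwv => ->; rewrite {2}/sort_key eqxx.
have inS z : z \in verts S -> z != hub S -> z \in S.
  move=> zT zh; have := mem_reps S z; rewrite inE zT orbT => /esym.
  by rewrite !inE (negPf zh).
have oS_hub : hub S \in verts S -> ord0 \in S.
  by rewrite mem_filter /hub; case: ifP => //; rewrite eqxx.
have wh : w != hub S.
  apply/eqP=> e; move: xw; rewrite e hx; last by rewrite oS_hub -?e.
  lia.
have vp : (block_label x v < p)%N by have := xm w; rewrite xw.
have ip : (0 < block_label x v < p)%N by rewrite v0.
apply: (IH (swap (block_label x v) x)).
  split.
  - by apply: (shape_relabel _ (fun z => swap_labelE x z ip) Sx) => r s _ _;
      apply: (can_inj (swap_labelK _)).
  - exact: (swap_neq0 Sp Sx (inS _ vS vh) (inS _ wS wh)).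
  move=> oS; rewrite swap_labelE // /swap_label hx // ifN ?ifN //.
    by rewrite eqSS eq_sym -lt0n.
  apply: contraNneq hS => e; rewrite (shape_single Sp Sx (inS _ vS vh) (w := hub S)) ?inS //.
  by rewrite hx.
have := sum_swap Sx vS wS vp xw; rewrite -/(W _) -/(W x); have := WM (swap (block_label x v) x).
lia.
Qed.

End ColoringCycle.
End Coloring.

Section UniformHomology.
Variables (F : fieldType) (n k : nat).
Hypothesis char0 : [pchar F] =i pred0.
Local Notation V := 'I_n.+1.
Local Notation H := (complete_uniform n.+1 k).
Implicit Types S : {set V}.

Section ColoringCycles.
Variable p : nat.
Hypotheses (pk : (p + k = n.+1)%N) (k3 : (2 < k)%N).
Local Notation cycles := (lker (bd F n.+1 p)).
Local Notation coloring := (coloring_complex F H p.+1).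

Lemma std_const_off_eq S S' : #|S| = p -> #|S'| = p -> const_off S (std S') -> S = S'.
Proof.
move=> Sp S'p /const_offP cS; apply/eqP; rewrite eq_sym eqEcard Sp S'p leqnn andbT.
have S'n : (#|S'| <= n)%N by rewrite S'p (p_le_n pk k3).
apply/subsetP=> v vS'; apply/negPn/negP=> vS.
have : (0 < #|~: S :\ v|)%N by have := cardC_set pk k3 Sp; rewrite (cardsD1 v) in_setC vS /=; lia.
case/card_gt0P=> w; rewrite !inE => /andP[wv wS].
have e : rep S' v = rep S' w.
  have := cS v w vS wS; rewrite !ffunE => /(congr1 (nth ord0 (ord0 :: verts S'))).
  by rewrite !nth_index ?rep_in.
move: e; rewrite /rep vS'; case: ifP => [_ e|_ e]; first by rewrite e eqxx in wv.
by have := hub_notin S'n; rewrite -e vS'.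
Qed.

Lemma dim_coloring_cycles : \dim (cycles :&: coloring)%VS = 'C(n.+1, p).
Proof.
have pn := p_le_n pk k3.
pose A := [set S : {set V} | #|S| == p].
have -> : 'C(n.+1, p) = #|A|.
  have := cards_draws (setT : {set V}) p; rewrite cardsT card_ord => <-.
  by apply: eq_card => S; rewrite !inE subsetT.
have stdx S : S \in A -> exists x : cbasis n.+1 p.+1, block_label x = std S.
  by rewrite inE => /eqP Sp; apply: block_label_onto; have := @std_normal n S; rewrite Sp; apply.
apply/eqP; rewrite eqn_leq; apply/andP; split.
  pose P (x : cbasis n.+1 p.+1) := [exists S in A, block_label x == std S].
  pose h (x : cbasis n.+1 p.+1) := odflt set0 [pick S in A | block_label x == std S].
  have hE x : P x -> h x \in A /\ block_label x = std (h x).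
    move=> /existsP[S hS]; rewrite /h; case: pickP => [S' /andP[SA /eqP]//|/(_ S)].
    by rewrite hS.
  have : (\dim (cycles :&: coloring) <= #|P|)%N.
    apply: dim_le_coord => c; rewrite memv_cap memv_ker => /andP[/eqP c_cyc c_col] cP.
    apply/ffunP=> x; rewrite [RHS]ffunE; apply/eqP/negPn/negP=> cx.
    have [S [y [Sp yS cy]]] := cycle_std_neq0 pk k3 c_cyc c_col cx.
    case/eqP: cy; apply: cP; apply/existsP; exists S.
    by rewrite inE Sp yS !eqxx.
  move/leq_trans; apply; rewrite -(@card_in_imset _ _ h P) => [|x y Px Py e].
    by apply/subset_leq_card/subsetP=> S /imsetP[x Px ->]; have [] := hE x Px.
  by apply: block_label_inj; have [_ ->] := hE x Px; have [_ ->] := hE y Py; rewrite e.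
rewrite -(card_sig (mem A)).
pose e (S : {S | S \in A}) : chain F n.+1 p.+1 := alt_chain F p (val S).
apply: (dim_ge_family (e := e)) => [S|a a0 S].
  have := valP S; rewrite inE => /eqP Sp.
  by rewrite memv_cap memv_ker alt_chain_cycle // eqxx alt_chain_coloring.
have [x xS] := stdx _ (valP S); have /eqP Sp : #|val S| == p by have := valP S; rewrite inE.
move/ffunP/(_ x): a0; rewrite sum_ffunE ffunE (bigD1 S) //= big1 ?addr0 => [|S' S'S].
  by rewrite ffunE alt_chain_std // /GRing.scale /= mulr1.
have /eqP S'p : #|val S'| == p by have := valP S'; rewrite inE.
rewrite ffunE; apply/eqP; rewrite scaler_eq0; apply/orP; right; apply: contraNT S'S.
case/(alt_chain_neq0 pn S'p)=> cS _; apply/eqP/val_inj/std_const_off_eq => //.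
by rewrite -xS.
Qed.

(* The alternating chains that avoid vertex 0 are coloring cycles and, with    *)
(* the boundaries, they span all cycles.                                       *)
Lemma dim_coloring_boundaries :
  (\dim (limg (bd F n.+1 p.+1) :&: coloring) + 'C(n, p) = 'C(n.+1, p))%N.
Proof.
set B := limg _; pose D := (cycles :&: coloring)%VS.
have BZ : (B <= cycles)%VS by apply/subvP=> c /memv_imgP[d _ ->]; rewrite memv_ker bd_bd.
have -> : (B :&: coloring = B :&: D)%VS by rewrite /D capvA (capv_idPl BZ).
have dBD : \dim (B + D)%VS = (#|lowers n p.+1| + #|criticals n p.+1|)%N.
  apply/eqP; rewrite eqn_leq; apply/andP; split.
    by rewrite -(dim_cycles _ char0) dimvS // subv_add BZ capvSl.
  apply: dim_ge_cycles => [|S _ Sp]; first exact: addvSl.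
  apply: (subvP (addvSr _ _)).
  by rewrite memv_cap memv_ker alt_chain_cycle // eqxx alt_chain_coloring.
have := dimv_sum_cap B D; rewrite dBD dim_coloring_cycles (dim_boundaries _ char0) -card_lowers.
by rewrite card_criticals; lia.
Qed.

End ColoringCycles.

Lemma dim_quotient_homology m : coloring_complex F H m.+1 = 0%VS ->
  \dim (homology (qbd F H m.+1) (qbd F H m))
  = ('C(n, m) + \dim (limg (bd F n.+1 m) :&: coloring_complex F H m))%N.
Proof.
move=> col0.
have limgE j : limg (qbd F H j) = (qproj F H j @: limg (bd F n.+1 j))%VS.
  apply/eqP; rewrite eqEsubv; apply/andP; split; apply/subvP=> c.
    case/memv_imgP=> d _ ->; rewrite -[d]qprojK qbd_qproj.
    by apply/memv_img/memv_img/memvf.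
  case/memv_imgP=> _ /memv_imgP[d _ ->] ->; rewrite -qbd_qproj.
  exact/memv_img/memvf.
have dlimg j : (\dim (limg (bd F n.+1 j) :&: coloring_complex F H j) + \dim (limg (qbd F H j))
    = \dim (limg (bd F n.+1 j)))%N by rewrite limgE -lker_qproj limg_ker_dim.
have BZ : (limg (qbd F H m.+1) <= lker (qbd F H m))%VS.
  rewrite limgE; apply/subvP=> _ /memv_imgP[_ /memv_imgP[d _ ->] ->].
  by rewrite memv_ker qbd_qproj bd_bd linear0.
have := dimv_cap_compl (lker (qbd F H m)) (limg (qbd F H m.+1)).
rewrite -/(homology _ _) (capv_idPr BZ).
have := dlimg m; have := dlimg m.+1; rewrite {1}col0 capv0 dimv0 add0n => ->.
rewrite !(dim_boundaries _ char0).
have := limg_ker_dim (qbd F H m) fullv; rewrite capfv.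
have <- : \dim (fullv : {vspace chain F n.+1 m.+1}) = \dim (fullv : {vspace qchain F H m.+1}).
  have := limg_ker_dim (qproj F H m.+1) fullv; rewrite capfv lker_qproj col0 dimv0 add0n => <-.
  congr (\dim _); apply/vspaceP=> c; rewrite memvf -[c]qprojK.
  exact/memv_img/memvf.
rewrite dim_ffun card_cells -(card_criticals n m) card_lowers; lia.
Qed.

End UniformHomology.

Theorem theorem3p2 (F : fieldType) (char0 : [pchar F] =i pred0)
    (n k : nat) (r : int) (r_gt : n%:Z - k%:Z < r) (r_le : r <= n%:Z - 2) :
  dimHC_quotient F (complete_uniform n k) r = binz n.-1 (r + 1)
  /\ dimHC_quotient F (complete_uniform n k) (n%:Z - k%:Z)
     = (binz n.-1 (n%:Z - k%:Z - 1) + binz n.-1 (n%:Z - k%:Z + 1))%N.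
Proof.
have binzE a j i : j = Posz i -> binz a j = 'C(a, i) by move->.
have binz_neg a j : j < 0 -> binz a j = 0%N by case: j.
have dimE (G : hypergraph n) j : j + 1 < 0 -> dimHC_quotient F G j = 0%N.
  by rewrite /dimHC_quotient; case: (j + 1).
case: (ltrP (r + 1) 0) => [r0|r0].
  by rewrite !dimE ?binz_neg //; lia.
case: n r_gt r_le dimE => [|n0] r_gt r_le dimE; first lia.
have [m rm] : exists m, r + 1 = Posz m by case: (r + 1) r0 => // m _; exists m.
have k3 : (2 < k)%N by lia.
split.
  rewrite (binzE _ _ m) // /dimHC_quotient rm dim_quotient_homology // ?coloring_complex0 //; try lia.
  by rewrite capv0 dimv0 addn0.
have [kn|kn] := leqP k n0.+1; last first.
  have [k2|k2] := eqVneq k n0.+2; last by rewrite dimE ?binz_neg //; lia.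
  rewrite binz_neg ?(binzE _ _ 0%N); try lia.
  rewrite /dimHC_quotient (_ : _ - _ + 1 = Posz 0); last lia.
  rewrite dim_quotient_homology //; last by apply: coloring_complex0; lia.
  by rewrite bin0 (_ : _ :&: _ = 0)%VS ?dimv0 //; apply/eqP; rewrite -dimv_eq0 -leqn0
    (leq_trans (dimvS (subvf _))) // dim_ffun leqn0; apply/eqP/eq_card0 => x; have := cbasis0 x.
have [p pk] : exists p, (p + k)%N = n0.+1.
  by exists (n0.+1 - k)%N; rewrite subnK.
rewrite /dimHC_quotient (_ : _ - _ + 1 = Posz p.+1); last lia.
rewrite dim_quotient_homology //; last by apply: coloring_complex0; lia.
rewrite addnC; congr (_ + _)%N.
have := dim_coloring_boundaries char0 pk k3.
have [p0|p0] := posnP p.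
  by rewrite binz_neg ?p0 ?bin0; lia.
rewrite (binzE _ _ p.-1); last lia.
by rewrite -[in 'C(n0.+1, _)](prednK p0) binS prednK //=; lia.
Qed.
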